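(* Let $I,J,M,N\subseteq\{1,\dots,n\}$ with $|I|=|J|$ and $|M|=|N|$. Then in $A=\mathcal{O}_q(M_n(k))$, $$q^{|I\cap M|}[I|J][M|N]+q^{|I\cap M|}\sum_{S\in\{<I\Vert M\}}\lambda_S\,[S|J][S^\natural|N]=q^{|J\cap N|}[M|N][I|J]+q^{|J\cap N|}\sum_{T\in\{>J\Vert N\}}\mu_T\,[M|T^\natural][I|T],$$ where $S^\natural=S^\natural_{I,M}$, $T^\natural=T^\natural_{J,N}$, and $$\lambda_S=\widehat{q}^{\,|I\setminus S|}(-q)^{\mathcal{L}(S,I,M)}\xi_q(I\setminus S;S\setminus I),\qquad \mu_T=\widehat{q}^{\,|T\setminus J|}(-q)^{\mathcal{L}^\natural(T,J,N)}\xi_q(T\setminus J;J\setminus T)$$ for $S\in\{<I\Vert M\}$ and $T\in\{>J\Vert N\}$.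
   Context: Let $k$ be a field, $n$ a positive integer, $q\in k^\times$, and $\widehat{q}=q-q^{-1}$. The algebra $A=\mathcal{O}_q(M_n(k))$ is the $k$-algebra with generators $X_{ij}$ ($1\le i,j\le n$) and relations: $X_{ij}X_{lj}=qX_{lj}X_{ij}$ for $i<l$; $X_{ij}X_{im}=qX_{im}X_{ij}$ for $j<m$; $X_{ij}X_{lm}=X_{lm}X_{ij}$ for $i<l$, $j>m$; $X_{ij}X_{lm}-X_{lm}X_{ij}=\widehat{q}\,X_{im}X_{lj}$ for $i<l$, $j<m$. Quantum minors: for $I=\{i_1<\cdots<i_t\}$ and $J=\{j_1<\cdots<j_t\}$, $[I|J]=\sum_{\sigma\in S_t}(-q)^{\ell(\sigma)}X_{i_1,j_{\sigma(1)}}\cdots X_{i_t,j_{\sigma(t)}}$, where $\ell(\sigma)$ is the length (number of inversions) of $\sigma$; $[\varnothing|\varnothing]=1$. For such $I,J$, $I\le J$ means $i_l\le j_l$ for all $l$; $I<J$ means $I\le J$ and $I\ne J$. For $S,T\subseteq\{1,\dots,n\}$, $\ell(S;T)=|\{(s,t)\in S\times T\mid s>t\}|$. For $d\in\mathbb{N}$, $[d]_{-q}=(-q)^{d-1}+(-q)^{d-3}+\cdots+(-q)^{-(d-1)}$. For index sets $U\ge V$ of the same cardinality $m$, write $U=\{r_1<\cdots<r_m\}$, set $d_l=|[1,r_l]\cap V|-l+1$ (which is $\ge1$) and define $\xi_q(U;V)=[d_1]_{-q}\cdots[d_m]_{-q}$, with $\xi_q(\varnothing;\varnothing)=1$. For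 $X,Y\subseteq\{1,\dots,n\}$: $\{<X\Vert Y\}=\{S\subseteq X\cup Y\mid X\cap Y\subseteq S,\ |S|=|X|,\ S<X\}$ and $\{>X\Vert Y\}=\{T\subseteq X\cup Y\mid X\cap Y\subseteq T,\ |T|=|X|,\ T>X\}$. For $X\cap Y\subseteq S\subseteq X\cup Y$, $S^\natural=S^\natural_{X,Y}=(X\cap Y)\sqcup\bigl((X\cup Y)\setminus S\bigr)$. For $S\in\{<X\Vert Y\}$ and $T\in\{>X\Vert Y\}$ (with $\natural$ taken relative to $X,Y$), $\mathcal{L}(S,X,Y)=\ell\bigl((S\setminus S^\natural)\cup(Y\setminus X);X\setminus S\bigr)-\ell\bigl((S\setminus S^\natural)\cup(Y\setminus X);S\setminus X\bigr)$, $\mathcal{L}^\natural(T,X,Y)=\ell\bigl((T^\natural\setminus T)\cup(X\setminus Y);T\setminus X\bigr)-\ell\bigl((T^\natural\setminus T)\cup(X\setminus Y);X\setminus T\bigr)$. *)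

(* Defs.v *)
From HB Require Import structures.
From mathcomp Require Import all_boot all_order all_fingroup all_algebra.
From mathcomp Require Import boolp finmap.
From mathcomp Require Import monalg.

Set Implicit Arguments.
Unset Strict Implicit.
Unset Printing Implicit Defensive.

Import GRing.Theory.
Local Open Scope ring_scope.
Local Open Scope quotient_scope.

Inductive two_sided_ideal (A : nzRingType) (P : A -> Prop) : A -> Prop :=
| ideal_gen a of P a : two_sided_ideal P a
| ideal_zero : two_sided_ideal P 0
| ideal_sub a b of two_sided_ideal P a & two_sided_ideal P b :
    two_sided_ideal P (a - b)
| ideal_mull c a of two_sided_ideal P a : two_sided_ideal P (c * a)
| ideal_mulr c a of two_sided_ideal P a : two_sided_ideal P (a * c).

Definition qhat (k : fieldType) (q : k) : k := q - q^-1.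

(* Indices 1, ..., n are represented by 0, ..., n-1 : 'I_n. *)
Section QuantumMatrixRelations.

Context (k : fieldType) (n : nat) (q : k).
Context (A : lalgType k) (x : 'I_n -> 'I_n -> A).

(* [qmx_rel r]: the relation r = 0 is one of the defining relations. *)
Inductive qmx_rel : A -> Prop :=
| qmx_rel_col (i l j : 'I_n) of (i < l)%N :
    qmx_rel (x i j * x l j - q *: (x l j * x i j))
| qmx_rel_row (i j m : 'I_n) of (j < m)%N :
    qmx_rel (x i j * x i m - q *: (x i m * x i j))
| qmx_rel_comm (i l j m : 'I_n) of (i < l)%N & (m < j)%N :
    qmx_rel (x i j * x l m - x l m * x i j)
| qmx_rel_cross (i l j m : 'I_n) of (i < l)%N & (j < m)%N :
    qmx_rel (x i j * x l m - x l m * x i j - qhat q *: (x i m * x l j)).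

Lemma qmx_rel_augmentation (f : A -> k) :
  {morph f : a b / a * b} -> {morph f : a b / a - b} ->
  (forall c a, f (c *: a) = c * f a) -> (forall i j, f (x i j) = 0) ->
  forall a, two_sided_ideal qmx_rel a -> f a = 0.
Proof.
move=> fM fB fZ fx.
have f0 : f 0 = 0 by rewrite -(subrr 0) fB subrr.
move=> a; elim=> {a} [a [] *||a b _ a0 _ b0|c a _ a0|c a _ a0];
  by rewrite ?fB ?fZ ?fM ?fx ?a0 ?b0 ?f0 ?mulr0 ?mul0r ?subr0.
Qed.

Definition qmx_relations (B : lalgType k) (y : 'I_n -> 'I_n -> B) : Prop :=
  [/\ forall i l j : 'I_n, (i < l)%N ->
        y i j * y l j = q *: (y l j * y i j),
      forall i j m : 'I_n, (j < m)%N ->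
        y i j * y i m = q *: (y i m * y i j),
      forall i l j m : 'I_n, (i < l)%N -> (m < j)%N ->
        y i j * y l m = y l m * y i j
    & forall i l j m : 'I_n, (i < l)%N -> (j < m)%N ->
        y i j * y l m - y l m * y i j = qhat q *: (y i m * y l j)].

Lemma qmx_rel_morph (B : lalgType k) (f : A -> B) :
  {morph f : a b / a * b} -> {morph f : a b / a - b} ->
  (forall c a, f (c *: a) = c *: f a) -> (forall a, qmx_rel a -> f a = 0) ->
  qmx_relations (fun i j => f (x i j)).
Proof.
move=> fM fB fZ f0; split=> [i l j il|i j m jm|i l j m il mj|i l j m il jm];
  apply: subr0_eq; rewrite -!fM -?fZ -!fB.
- exact/f0/qmx_rel_col.
- exact/f0/qmx_rel_row.
- exact/f0/qmx_rel_comm.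
- exact/f0/qmx_rel_cross.
Qed.

End QuantumMatrixRelations.

Section QuantumMatrixAlgebra.

Context (k : fieldType) (n : nat) (q : k).

Local Notation free_alg := {malg k[{fmonom ('I_n * 'I_n)%type}]}.

Definition free_gen (i j : 'I_n) : free_alg := << fmu (i, j) >>.

Definition qmx_ideal : {pred free_alg} :=
  fun a => `[< two_sided_ideal (qmx_rel q free_gen) a >].

Lemma qmx_idealP a :
  reflect (two_sided_ideal (qmx_rel q free_gen) a) (a \in qmx_ideal).
Proof. exact: asboolP. Qed.

Fact qmx_ideal_zmod_closed : zmod_closed qmx_ideal.
Proof.
split=> [|a b /qmx_idealP Ia /qmx_idealP Ib]; apply/qmx_idealP.
  exact: ideal_zero.
exact: ideal_sub.
Qed.

HB.instance Definition _ :=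
  GRing.isZmodClosed.Build free_alg qmx_ideal qmx_ideal_zmod_closed.

Lemma qmx_idealMl c a : a \in qmx_ideal -> c * a \in qmx_ideal.
Proof. by move=> /qmx_idealP Ia; apply/qmx_idealP/ideal_mull. Qed.

Lemma qmx_idealMr c a : a \in qmx_ideal -> a * c \in qmx_ideal.
Proof. by move=> /qmx_idealP Ia; apply/qmx_idealP/ideal_mulr. Qed.

Lemma qmx_idealZ (c : k) a : a \in qmx_ideal -> c *: a \in qmx_ideal.
Proof. by rewrite -mul_malgC; exact: qmx_idealMl. Qed.

Fact free_scalerAr (c : k) (a b : free_alg) : c *: (a * b) = a * (c *: b).
Proof.
have le_b : (msupp (c *: b) `<=` msupp b)%fset.
  apply/fsubsetP=> m; rewrite -!mcoeff_neq0 mcoeffZ.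
  by apply: contra_neq => ->; rewrite mulr0.
apply/malgP=> m; rewrite mcoeffZ.
rewrite [in LHS]mcoeffMl.
rewrite (mcoeffMlw m (fsubset_refl (msupp a)) le_b) mulr_sumr.
apply: eq_bigr => m1 _; rewrite mulr_sumr; apply: eq_bigr => m2 _.
by rewrite mcoeffZ mulrnAr mulrCA.
Qed.

Fact qmx_ideal_proper : 1 \notin qmx_ideal.
Proof.
have [f1M f11] := mcoeff1g_is_multiplicative {fmonom ('I_n * 'I_n)%type} k.
apply/negP=> /qmx_idealP /(qmx_rel_augmentation f1M (mcoeffB _)) I0.
have /eqP : mcoeff mone (1 : free_alg) = 0 :> k.
  apply: I0 => [c a|i j]; first exact: mcoeffZ.
  by rewrite mcoeffU1 -val_eqE /= fmU fm1.
by rewrite f11 oner_eq0.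
Qed.

Definition qmx := Quotient.quot qmx_ideal.
HB.instance Definition _ := GRing.Zmodule.on qmx.

Definition qmx_pi (a : free_alg) : qmx := \pi_(Quotient.quot qmx_ideal) a.
Definition qmx_repr (u : qmx) : free_alg :=
  generic_quotient.repr (u : Quotient.quot qmx_ideal).

Lemma qmx_reprK u : qmx_pi (qmx_repr u) = u.
Proof. exact: reprK. Qed.

Lemma qmx_pi_eq a b : (qmx_pi a == qmx_pi b) = (a - b \in qmx_ideal).
Proof. by rewrite Quotient.idealrBE. Qed.

Lemma qmx_piD a b : qmx_pi (a + b) = qmx_pi a + qmx_pi b.
Proof. exact: (raddfD (\pi_(Quotient.quot qmx_ideal))). Qed.

Lemma qmx_pi0 : qmx_pi 0 = 0.
Proof. exact: (raddf0 (\pi_(Quotient.quot qmx_ideal))). Qed.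

Lemma qmx_repr_pi a : qmx_repr (qmx_pi a) - a \in qmx_ideal.
Proof. by rewrite -qmx_pi_eq qmx_reprK. Qed.

Definition qmx_one : qmx := qmx_pi 1.
Definition qmx_mul (u v : qmx) : qmx := qmx_pi (qmx_repr u * qmx_repr v).
Definition qmx_scale (c : k) (u : qmx) : qmx := qmx_pi (c *: qmx_repr u).

Lemma qmx_mulE a b : qmx_mul (qmx_pi a) (qmx_pi b) = qmx_pi (a * b).
Proof.
apply/eqP; rewrite qmx_pi_eq.
set a' := qmx_repr _; set b' := qmx_repr _.
have -> : a' * b' - a * b = (a' - a) * b' + a * (b' - b).
  by rewrite mulrBl mulrBr addrA subrK.
apply: rpredD; first exact/qmx_idealMr/qmx_repr_pi.
exact/qmx_idealMl/qmx_repr_pi.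
Qed.

Lemma qmx_scaleE c a : qmx_scale c (qmx_pi a) = qmx_pi (c *: a).
Proof.
by apply/eqP; rewrite qmx_pi_eq -scalerBr; apply/qmx_idealZ/qmx_repr_pi.
Qed.

Let qmxE := (qmx_mulE, qmx_scaleE, qmx_piD).

Fact qmx_mulA : associative qmx_mul.
Proof.
move=> u v w; rewrite -[u]qmx_reprK -[v]qmx_reprK -[w]qmx_reprK.
by rewrite !qmxE mulrA.
Qed.

Fact qmx_mul1 : left_id qmx_one qmx_mul.
Proof. by move=> u; rewrite -[u]qmx_reprK qmxE mul1r. Qed.

Fact qmx_mulr1 : right_id qmx_one qmx_mul.
Proof. by move=> u; rewrite -[u]qmx_reprK qmxE mulr1. Qed.

Fact qmx_mulDl : left_distributive qmx_mul +%R.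
Proof.
move=> u v w; rewrite -[u]qmx_reprK -[v]qmx_reprK -[w]qmx_reprK.
by rewrite -qmx_piD !qmx_mulE mulrDl qmx_piD.
Qed.

Fact qmx_mulDr : right_distributive qmx_mul +%R.
Proof.
move=> u v w; rewrite -[u]qmx_reprK -[v]qmx_reprK -[w]qmx_reprK.
by rewrite -qmx_piD !qmx_mulE mulrDr qmx_piD.
Qed.

Fact qmx_oner_neq0 : qmx_one != 0.
Proof.
by rewrite -qmx_pi0 qmx_pi_eq subr0 qmx_ideal_proper.
Qed.

HB.instance Definition _ := GRing.Zmodule_isNzRing.Build qmx
  qmx_mulA qmx_mul1 qmx_mulr1 qmx_mulDl qmx_mulDr qmx_oner_neq0.

Fact qmx_scaleA c d u : qmx_scale c (qmx_scale d u) = qmx_scale (c * d) u.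
Proof. by rewrite -[u]qmx_reprK !qmxE scalerA. Qed.

Fact qmx_scale1 : left_id 1 qmx_scale.
Proof. by move=> u; rewrite -[u]qmx_reprK qmxE scale1r. Qed.

Fact qmx_scaleDr : right_distributive qmx_scale +%R.
Proof.
move=> c u v; rewrite -[u]qmx_reprK -[v]qmx_reprK.
by rewrite -qmx_piD !qmx_scaleE scalerDr qmx_piD.
Qed.

Fact qmx_scaleDl u : {morph qmx_scale^~ u : c d / c + d}.
Proof.
by move=> c d; rewrite -[u]qmx_reprK /= !qmx_scaleE scalerDl qmx_piD.
Qed.

HB.instance Definition _ := GRing.Zmodule_isLmodule.Build k qmx
  qmx_scaleA qmx_scale1 qmx_scaleDr qmx_scaleDl.

Fact qmx_scaleAl (c : k) (u v : qmx) : c *: (u * v) = (c *: u) * v.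
Proof.
rewrite -[u]qmx_reprK -[v]qmx_reprK; set a := qmx_repr u; set b := qmx_repr v.
rewrite /GRing.scale/= /GRing.mul/= !(qmx_mulE, qmx_scaleE).
by rewrite scalerAl.
Qed.

HB.instance Definition _ := GRing.Lmodule_isLalgebra.Build k qmx qmx_scaleAl.

Fact qmx_scaleAr (c : k) (u v : qmx) : c *: (u * v) = u * (c *: v).
Proof.
rewrite -[u]qmx_reprK -[v]qmx_reprK; set a := qmx_repr u; set b := qmx_repr v.
rewrite /GRing.scale/= /GRing.mul/= !(qmx_mulE, qmx_scaleE).
by rewrite free_scalerAr.
Qed.

HB.instance Definition _ := GRing.Lalgebra_isAlgebra.Build k qmx qmx_scaleAr.

Definition qmx_gen (i j : 'I_n) : qmx := qmx_pi (free_gen i j).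

Lemma qmx_pi_rel a : qmx_rel q free_gen a -> qmx_pi a = 0.
Proof.
move=> Ra; apply/eqP; rewrite -qmx_pi0 qmx_pi_eq subr0.
by apply/qmx_idealP/ideal_gen.
Qed.

Lemma qmx_genP : qmx_relations q qmx_gen.
Proof.
apply: (qmx_rel_morph _ _ _ qmx_pi_rel) => [a b|a b|c a].
- by rewrite -qmx_mulE.
- exact: (raddfB (\pi_(Quotient.quot qmx_ideal))).
- by rewrite -qmx_scaleE.
Qed.

Definition perm_length (t : nat) (s : 'S_t) : nat :=
  #|[set p : 'I_t * 'I_t | (p.1 < p.2)%N && (s p.2 < s p.1)%N]|.

(* [I|J].  [enum] lists a subset of 'I_n in increasing order, so                *)
(* [nth (enum_val l) (enum J) (s l)] is j_{s(l)} when #|I| = #|J| (the default  *)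
(* value is then never used); the value is meaningless when #|I| != #|J|.       *)
Definition qminor (I J : {set 'I_n}) : qmx :=
  \sum_(s : 'S_#|I|) (- q) ^+ perm_length s *:
    \prod_(l < #|I|) qmx_gen (enum_val l) (nth (enum_val l) (enum J) (s l)).

End QuantumMatrixAlgebra.

Section IndexSets.

Context (n : nat).
Implicit Types (I J S T U V X Y : {set 'I_n}).

(* [all2] also requires the two lists to have the same length. *)
Definition index_le I J := all2 (fun i j : 'I_n => (i <= j)%N) (enum I) (enum J).

Definition index_lt I J := index_le I J && (I != J).

Definition ell S T : nat := #|[set p in setX S T | (p.2 < p.1)%N]|.

Definition lt_sets X Y : {set {set 'I_n}} :=
  [set S : {set 'I_n} | [&& S \subset X :|: Y, X :&: Y \subset S,
                            #|S| == #|X| & index_lt S X]].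

Definition gt_sets X Y : {set {set 'I_n}} :=
  [set T : {set 'I_n} | [&& T \subset X :|: Y, X :&: Y \subset T,
                            #|T| == #|X| & index_lt X T]].

Definition natural X Y S := (X :&: Y) :|: ((X :|: Y) :\: S).

Definition calL S X Y : int :=
  let W := (S :\: natural X Y S) :|: (Y :\: X) in
  (ell W (X :\: S))%:Z - (ell W (S :\: X))%:Z.

Definition calL_natural T X Y : int :=
  let W := (natural X Y T :\: T) :|: (X :\: Y) in
  (ell W (T :\: X))%:Z - (ell W (X :\: T))%:Z.

Context (k : fieldType) (q : k).

(* [d]_{-q} *)
Definition qnum (d : nat) : k :=
  \sum_(i < d) (- q) ^ (d%:Z - 1 - (2 * i)%N%:Z).

(* Here l is counted from 0, so d_{l+1} = |[1,r_{l+1}] cap V| - l; the natural  *)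
(* number subtraction is exact when U >= V.                                     *)
Definition xi U V : k :=
  \prod_(l < #|U|) qnum (#|[set v in V | (v <= enum_val l)%N]| - l).

Definition lambda I M S : k :=
  qhat q ^+ #|I :\: S| * (- q) ^ calL S I M * xi (I :\: S) (S :\: I).

Definition mu J N T : k :=
  qhat q ^+ #|T :\: J| * (- q) ^ calL_natural T J N * xi (T :\: J) (J :\: T).

End IndexSets.

(* Main.v *)
Require Import Defs.
From mathcomp Require Import all_boot all_order all_fingroup all_algebra.
From mathcomp Require Import ring zify.

(* Put z = -q.  In the sum over S, the coefficient q^|I :&: M| * lambda_S is    *)
(* the entry of the braiding of two quantum exterior powers at the basis        *)
(* vectors (I, M) and (S, S'), and q^|J :&: N| * mu_T is the entry of the same  *)
(* matrix at (T, T') and (J, N).  Since qhat * [d]_{-q} = z^-d - z^d, such an   *)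
(* entry is a product of local weights over the indices p, where the weight at  *)
(* p depends only on which of the four sets contain p and on the height         *)
(* h_p = #{s in S | s < p} - #{i in I | i < p}.  The theorem says that this     *)
(* matrix intertwines [S|J][S'|N] and [M|T'][I|T].  For 1 x 1 minors this is    *)
(* the defining relations.  The general case follows by induction, first on     *)
(* #|M| with #|I| = 1 and then on #|I|, from the expansion of a minor along a   *)
(* row and from the naturality of the braiding with respect to the exterior     *)
(* product in each of the two factors; the same naturality identity treats the  *)
(* sum over S and the sum over T.                                               *)

Set Implicit Arguments.
Unset Strict Implicit.
Unset Printing Implicit Defensive.

Import Order.TTheory GRing.Theory Num.Theory.
Local Open Scope ring_scope.

(** * Counting below, above and between *)

Section Counting.

(** A minor is a matrix coefficient of a quantum exterior power. [minor_insert] says that these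
    coefficients respect the product of the basis vector of [S] with that of [s], which is
    [z ^+ above S s] times the basis vector of [s |: S], or zero for [s] in [S]. [braid_natural] and
    [braid1_natural] say that the braiding respects the same product. Hence the relation for two
    generators, [gen_comm], passes to a generator and a minor ([gen_minor_braid]) and then to two
    minors ([minor_braid]). [sum_braid_left] and [sum_braid_right] read the two sums of the theorem
    off a row and a column of the braiding matrix, with coefficients computed in [braid_lambda] and
    [mu_lambda]; [qminorE] identifies the recursive minors with the sums over permutations. *)

Definition below n (A : {set 'I_n}) (p : 'I_n) : nat :=
  #|[set a in A | (a < p)%N]|.

Definition above n (A : {set 'I_n}) (p : 'I_n) : nat :=
  #|[set a in A | (p < a)%N]|.

Definition between n (A : {set 'I_n}) (p r : 'I_n) : nat :=
  #|[set a in A | (p < a < r)%N]|.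

Definition set_tail n (A : {set 'I_n.+1}) : {set 'I_n} :=
  [set i | lift ord0 i \in A].

Lemma cardset_bool n (P : pred 'I_n) : #|[set a | P a]| = (\sum_a P a)%N.
Proof. by rewrite -sum1dep_card big_mkcond; apply: eq_bigr => a _; case: (P a). Qed.

Lemma card_sum_mem n (A : {set 'I_n}) : #|A| = (\sum_a (a \in A))%N.
Proof. by rewrite -sum1_card big_mkcond; apply: eq_bigr => a _; case: (a \in A). Qed.

Lemma card_set_tail n (A : {set 'I_n.+1}) :
  #|A| = ((ord0 \in A) + #|set_tail A|)%N.
Proof.
rewrite !card_sum_mem big_ord_recl; congr addn.
by apply: eq_bigr => a _; rewrite inE.
Qed.

Lemma below0 n (A : {set 'I_n.+1}) : below A ord0 = 0%N.
Proof. by apply: eq_card0 => a; rewrite !inE andbF. Qed.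

Lemma below_lift n (A : {set 'I_n.+1}) p :
  below A (lift ord0 p) = ((ord0 \in A) + below (set_tail A) p)%N.
Proof.
rewrite /below !cardset_bool big_ord_recl andbT; congr addn.
by apply: eq_bigr => a _; rewrite inE.
Qed.

Lemma above0 n (A : {set 'I_n.+1}) : above A ord0 = #|set_tail A|.
Proof.
rewrite /above cardset_bool card_sum_mem big_ord_recl andbF add0n.
by apply: eq_bigr => a _; rewrite inE andbT.
Qed.

Lemma above_lift n (A : {set 'I_n.+1}) p :
  above A (lift ord0 p) = above (set_tail A) p.
Proof.
rewrite /above !cardset_bool big_ord_recl andbF add0n.
by apply: eq_bigr => a _; rewrite inE.
Qed.

Lemma between0_lift n (A : {set 'I_n.+1}) p :
  between A ord0 (lift ord0 p) = below (set_tail A) p.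
Proof.
rewrite /between /below !cardset_bool big_ord_recl andbF add0n.
by apply: eq_bigr => a _; rewrite inE.
Qed.

Lemma between_lift n (A : {set 'I_n.+1}) p r :
  between A (lift ord0 p) (lift ord0 r) = between (set_tail A) p r.
Proof.
rewrite /between !cardset_bool big_ord_recl andbF add0n.
by apply: eq_bigr => a _; rewrite inE.
Qed.

Lemma set_tailD0 n (A : {set 'I_n.+1}) : set_tail (A :\ ord0) = set_tail A.
Proof. by apply/setP => a; rewrite !inE. Qed.

Lemma set_tailU0 n (A : {set 'I_n.+1}) : set_tail (ord0 |: A) = set_tail A.
Proof. by apply/setP => a; rewrite !inE. Qed.

Lemma set_tailD1 n (A : {set 'I_n.+1}) p :
  set_tail (A :\ lift ord0 p) = set_tail A :\ p.
Proof. by apply/setP => a; rewrite !inE (inj_eq lift_inj). Qed.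

Lemma set_tailU1 n (A : {set 'I_n.+1}) p :
  set_tail (lift ord0 p |: A) = p |: set_tail A.
Proof. by apply/setP => a; rewrite !inE (inj_eq lift_inj). Qed.

End Counting.

(** * The braiding matrix *)

Section Braiding.

Context (k : fieldType) (z : k).

(* The case (true, false, false, true), an index of I :\: S, is qhat * [h].     *)
(* It vanishes at h = 0, so a path of heights starting at 0 never goes below 0. *)
Definition braid_wt (h : int) (i m s s' : bool) : k :=
  match i, m, s, s' with
  | false, false, false, false => 1
  | true, true, true, true => - z
  | true, false, false, true => z ^ (- h) - z ^ h
  | false, true, true, false
  | true, false, true, false
  | false, true, false, true => z ^ (- h)
  | _, _, _, _ => 0
  end.

Definition height n (h : int) (I S : {set 'I_n}) (p : 'I_n) : int :=
  h + (below S p)%:Z - (below I p)%:Z.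

(** The first factor forces the path of heights that starts at [h] to end at 0; for [h = 0] it says
    that [S] and [I] have the same size. *)
Definition braid n (h : int) (I M S S' : {set 'I_n}) : k :=
  (h + #|S|%:Z - #|I|%:Z == 0)%:R *
  \prod_(p < n) braid_wt (height h I S p) (p \in I) (p \in M) (p \in S) (p \in S').

(** Removing the index 0 shifts the starting height of the remaining path, which is why [h] is a
    parameter of [braid]. *)
Lemma braidS n h (I M S S' : {set 'I_n.+1}) :
  braid h I M S S' =
    braid_wt h (ord0 \in I) (ord0 \in M) (ord0 \in S) (ord0 \in S') *
    braid (h + (ord0 \in S)%:Z - (ord0 \in I)%:Z)
      (set_tail I) (set_tail M) (set_tail S) (set_tail S').
Proof.
rewrite /braid big_ord_recl /height !below0 addr0 subr0 mulrCA.
congr (_ * (_%:R * _)).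
  rewrite (card_set_tail S) (card_set_tail I) !PoszD.
  by congr ((_ == _) : nat); ring.
apply: eq_bigr => p _; rewrite !below_lift !inE !PoszD.
by congr braid_wt; ring.
Qed.

Context (z_neq0 : z != 0).

Lemma braid_card n h (I M S S' : {set 'I_n}) :
  braid h I M S S' != 0 -> z ^+ #|S| = z ^ (- h) * z ^+ #|I|.
Proof.
rewrite /braid; case: (_ =P 0 :> int) => [e _|_]; last by rewrite mul0r eqxx.
by rewrite !exprnP -expfzDr //; congr (_ ^ _); lia.
Qed.

(* [move_wt t j N] is the entry of the braiding at ({t}, M) and ({j}, N), for    *)
(* the only M where it can be nonzero, namely [move t j N].                     *)
Definition move_wt n (t j : 'I_n) (N : {set 'I_n}) : k :=
  if j == t then (if t \in N then - z else 1)
  else if [&& (j < t)%N, j \notin N & t \in N] then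
    (z^-1 - z) * z ^- between N j t
  else 0.

Definition move n (t j : 'I_n) (N : {set 'I_n}) : {set 'I_n} :=
  if j == t then N else j |: (N :\ t).

Lemma move_wt_lift n (t j : 'I_n) (N : {set 'I_n.+1}) :
  move_wt (lift ord0 t) (lift ord0 j) N = move_wt t j (set_tail N).
Proof. by rewrite /move_wt (inj_eq lift_inj) !inE between_lift. Qed.

Lemma move_wt0_lift n (t : 'I_n) (N : {set 'I_n.+1}) :
  move_wt (lift ord0 t) ord0 N =
    (ord0 \notin N)%:R * (t \in set_tail N)%:R * (z^-1 - z) * z ^- below (set_tail N) t.
Proof.
rewrite /move_wt /= inE between0_lift; case: (_ \in N) => /=; first by rewrite !mul0r.
by case: ifP => _; rewrite ?mulr0 ?mul1r ?mul0r.
Qed.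

Lemma move_wt_lift0 n (j : 'I_n) (N : {set 'I_n.+1}) :
  move_wt ord0 (lift ord0 j) N = 0.
Proof. by []. Qed.

Lemma set_tail_move n (t j : 'I_n) (N : {set 'I_n.+1}) :
  set_tail (move (lift ord0 t) (lift ord0 j) N) = move t j (set_tail N).
Proof.
rewrite /move (inj_eq lift_inj); case: ifP => // _.
by rewrite set_tailU1 set_tailD1.
Qed.

Lemma move0_lift n (t j : 'I_n) (N : {set 'I_n.+1}) :
  (ord0 \in move (lift ord0 t) (lift ord0 j) N) = (ord0 \in N).
Proof. by rewrite /move (inj_eq lift_inj); case: ifP => //; rewrite !inE. Qed.

(* The instance h = 0 is the naturality; for the induction that removes the     *)
(* index 0 the sum has to be started at an arbitrary height, which adds to it   *)
(* the boundary term of a telescoping sum.                                      *)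
Lemma braid_natural_gen n h (T M J N : {set 'I_n}) (t : 'I_n) :
  \sum_(j in J) z ^+ above J j *
     (braid h T M (J :\ j) (move t j N) * move_wt t j N)
  + (z^-1 - z ^ (h + h - 1)) *
    ((t \in N)%:R * z ^+ #|J| * z ^- below N t * braid (h - 1) T M J (N :\ t))
  = (t \notin T)%:R * z ^+ above T t * braid h (t |: T) M J N.
Proof.
elim: n h T M J N t => [|n IHn] h T M J N t; first by case: t.
have zD a b : z ^ (a + b) = z ^ a * z ^ b by exact: expfzDr.
have g_neq0 : z ^ h != 0 by exact: expfz_neq0.
rewrite big_mkcond big_ord_recl /=.
case: (unliftP ord0 t) => [t'|] ->{t}.
  (* [X] is the height just after the index 0; the next step separates the contribution of that
     index from the sum over the tails. *)
  set X := h + (ord0 \in J)%:Z - (ord0 \in T)%:Z.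
  transitivity (
    (if ord0 \in J then z ^+ #|set_tail J| *
     (braid_wt h (ord0 \in T) (ord0 \in M) false true *
      braid (X - 1) (set_tail T) (set_tail M) (set_tail J) (set_tail N :\ t') *
      ((ord0 \notin N)%:R * (t' \in set_tail N)%:R * (z^-1 - z) * z ^- below (set_tail N) t')) else 0)
    + braid_wt h (ord0 \in T) (ord0 \in M) (ord0 \in J) (ord0 \in N) *
    \sum_(j in set_tail J) z ^+ above (set_tail J) j *
     (braid X (set_tail T) (set_tail M) (set_tail J :\ j) (move t' j (set_tail N)) * move_wt t' j (set_tail N))
  + (z^-1 - z ^ (h + h - 1)) *
    ((t' \in set_tail N)%:R * z ^+ ((ord0 \in J) + #|set_tail J|) * z ^- ((ord0 \in N) + below (set_tail N) t') *
     (braid_wt (h - 1) (ord0 \in T) (ord0 \in M) (ord0 \in J) (ord0 \in N) *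
      braid (X - 1) (set_tail T) (set_tail M) (set_tail J) (set_tail N :\ t')))).
    congr (_ + _ + _).
    - case: ifP => // J0; rewrite above0 move_wt0_lift braidS !inE /=.
      have -> : X - 1 = h + 0 - (ord0 \in T)%:Z by rewrite /X J0; lia.
      by rewrite /move /= set_tailD0 set_tailU0 set_tailD1.
    - rewrite big_distrr [RHS]big_mkcond /=; apply: eq_bigr => j _.
      rewrite inE; case: ifP => // _.
      rewrite above_lift move_wt_lift braidS move0_lift set_tail_move set_tailD1 !inE /=.
      by ring.
    - rewrite below_lift (card_set_tail J) braidS set_tailD1 !inE /=.
      by have -> : X - 1 = h - 1 + (ord0 \in J)%:Z - (ord0 \in T)%:Z by rewrite /X; lia.
  (* The boundary term of the induction hypothesis absorbs the term [j = ord0] and the boundary term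
     of the goal. *)
  have := IHn X (set_tail T) (set_tail M) (set_tail J) (set_tail N) t'.
  move/(canRL (addrK _)) => ->.
  rewrite above_lift braidS set_tailU1 !inE /= -/X !exprD !invfM.
  have zX : z ^ X = z ^ h * z ^+ (ord0 \in J) / z ^+ (ord0 \in T).
    by rewrite /X !zD exprnN.
  clearbody X; rewrite !zD !zX.
  move: (braid X _ _ _ _) (braid (X - 1) _ _ _ _) => R B.
  clear X zX.
  have zh : z ^ (-h) = (z ^ h)^-1 by rewrite invr_expz.
  (* One rational identity for each of the sixteen membership patterns at the index 0. *)
  rewrite /braid_wt; case: (ord0 \in T); case: (ord0 \in M); case: (ord0 \in J); case: (ord0 \in N) => /=;
  rewrite ?(opprD, opprK, zD, zh, mul0r, mulr0, mul1r, mulr1, expr0, expr1, invr1, addr0, exprN1) //;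
  move: (z ^ h) (z ^- _) g_neq0 => g b g0; 
    try by field; rewrite ?g0 ?z_neq0.
  (* Case [t = ord0]: no index lies below [t], so only [j = ord0] contributes. *)
  rewrite (_ : \sum_(i < n) _ = 0) ?addr0; last first.
    by apply: big1 => j _; rewrite move_wt_lift0 !mulr0 if_same.
  rewrite !above0 below0 !braidS set_tailU0 !set_tailD0 /move /move_wt eqxx (card_set_tail J) !inE /=.
  have zh : z ^ (-h) = (z ^ h)^-1 by rewrite invr_expz.
  pose B Y := braid Y (set_tail T) (set_tail M) (set_tail J) (set_tail N).
  (* The end condition on the heights enters here: wherever [B] is nonzero it expresses
     [z ^+ #|set_tail J|] by [z ^+ #|set_tail T|]. *)
  rewrite -!/(B _).
  have BE Y : (B Y == 0) || (z ^+ #|set_tail J| == (z ^ Y)^-1 * z ^+ #|set_tail T|).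
    by case: eqVneq => //= /braid_card ->; rewrite invr_expz.
  rewrite exprD; move: (z ^+ #|set_tail J|) (z ^+ #|set_tail T|) BE => P Q BE.
  clearbody B; case: (ord0 \in T); case: (ord0 \in J) => /=.
  - rewrite (_ : h + 0%Z - 1%Z = h - 1); last by lia.
    rewrite (_ : h - 1 + 1%Z - 1%Z = h - 1); last by lia.
    rewrite !zD zh; case/orP: (BE (h - 1)) => /eqP ->; first by rewrite !(mulr0, mul0r, addr0).
    by case: (ord0 \in M); case: (ord0 \in N) => /=; 
      rewrite ?(opprD, opprK, zD, zh, exprN1, expr1z); field; rewrite ?g_neq0 ?z_neq0 ?oner_neq0.
  - by case: (ord0 \in M); rewrite /= ?(mulr0, mul0r, addr0).
  - rewrite (_ : h + 0%Z - 0%Z = h); last by lia.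
    rewrite (_ : h + 1%Z - 1%Z = h); last by lia.
    rewrite (_ : h - 1 + 1%Z - 0%Z = h); last by lia.
    rewrite !zD zh; case/orP: (BE h) => /eqP ->; first by rewrite !(mulr0, mul0r, addr0).
    by case: (ord0 \in M); case: (ord0 \in N) => /=; 
      rewrite ?(opprD, opprK, zD, zh, exprN1, expr1z); field; rewrite ?g_neq0 ?z_neq0 ?oner_neq0.
  - rewrite (_ : h + 0%Z - 1%Z = h - 1); last by lia.
    rewrite (_ : h - 1 + 0%Z - 0%Z = h - 1); last by lia.
    rewrite !zD zh; case/orP: (BE (h - 1)) => /eqP ->; first by rewrite !(mulr0, mul0r, addr0).
    by case: (ord0 \in M); case: (ord0 \in N) => /=; 
      rewrite ?(opprD, opprK, zD, zh, exprN1, expr1z); field; rewrite ?g_neq0 ?z_neq0 ?oner_neq0.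
Qed.

Definition braid1 n (i : 'I_n) (M : {set 'I_n}) (s : 'I_n) (S' : {set 'I_n}) : k :=
  (M == move i s S')%:R * move_wt i s S'.

(** At height 0 the boundary factor [z^-1 - z ^ (0 + 0 - 1)] vanishes. The product of [T] and [t] is
    braided with [M] one factor at a time, [M'] being the intermediate set. *)
Lemma braid_natural n (T M J N : {set 'I_n}) (t : 'I_n) :
  \sum_(j in J) z ^+ above J j *
     \sum_M' braid 0 T M (J :\ j) M' * braid1 t M' j N
  = (t \notin T)%:R * z ^+ above T t * braid 0 (t |: T) M J N.
Proof.
rewrite -braid_natural_gen addr0 sub0r exprN1 subrr mul0r addr0.
apply: eq_bigr => j _; congr (_ * _).
rewrite (bigD1 (move t j N)) //= /braid1 eqxx mul1r big1 ?addr0 // => M' /negPf ->.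
by rewrite mul0r mulr0.
Qed.

End Braiding.

(** * Counting lemmas for splitting an interval and removing an element *)

Section CountingSplit.
Context (n : nat).
Implicit Types (A : {set 'I_n}) (p r x : 'I_n).

Lemma above_split A p r : (p < r)%N ->
  above A p = (between A p r + (r \in A) + above A r)%N.
Proof.
move=> pr; rewrite /above /between !cardset_bool.
rewrite -[X in (_ + X + _)%N]mul1n -(big_pred1_eq addn r (fun a => 1 * (a \in A))%N).
rewrite [X in (_ + X + _)%N]big_mkcond -!big_split; apply: eq_bigr => a _ /=.
case: (a \in A) => /=; last by rewrite if_same.
have -> : (a == r) = (a == r :> nat) by [].
by case: eqP; lia.
Qed.

Lemma between_split A p x r : (p < x < r)%N ->
  between A p r = (between A p x + (x \in A) + between A x r)%N.
Proof.
move=> pxr; rewrite /between !cardset_bool.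
rewrite -[X in (_ + X + _)%N]mul1n -(big_pred1_eq addn x (fun a => 1 * (a \in A))%N).
rewrite [X in (_ + X + _)%N]big_mkcond -!big_split; apply: eq_bigr => a _ /=.
case: (a \in A) => /=; last by rewrite if_same.
have -> : (a == x) = (a == x :> nat) by [].
by case: eqP; lia.
Qed.

Lemma aboveD1 A x p : above A p = (((x \in A) && (p < x)) + above (A :\ x) p)%N.
Proof.
rewrite /above (cardsD1 x) !inE; congr (_ + _)%N.
by apply: eq_card => a; rewrite !inE andbA.
Qed.

Lemma aboveU1 A x p : x \notin A -> above (x |: A) p = ((p < x) + above A p)%N.
Proof. by move=> xA; rewrite (aboveD1 _ x) setU11 setU1K. Qed.

Lemma betweenD1 A x p r :
  between A p r = (((x \in A) && (p < x < r)) + between (A :\ x) p r)%N.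
Proof.
rewrite /between (cardsD1 x) !inE; congr (_ + _)%N.
by apply: eq_card => a; rewrite !inE andbA.
Qed.

End CountingSplit.

(** * Naturality of the braiding in the second factor, for a single vector in the first *)

Section RankOneBraiding.
Context (k : fieldType) (z : k).
Context (z_neq0 : z != 0).

(** The R-matrix of the defining relations: with [z = - q], the entries [- z] and [z^-1 - z] are [q]
    and [qhat q]. *)
Definition braid11 n (i m u p : 'I_n) : k :=
  ((u == i) && (p == m))%:R * (if i == m then - z else 1) +
  ((u == m) && (p == i))%:R * ((m < i)%N%:R * (z^-1 - z)).

Lemma braid11_sum n (i m p : 'I_n) (F : 'I_n -> k) :
  \sum_u braid11 i m u p * F u =
  (p == m)%:R * (if i == m then - z else 1) * F i +
  (p == i)%:R * ((m < i)%N%:R * (z^-1 - z)) * F m.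
Proof.
under eq_bigr => u _ do rewrite /braid11 mulrDl.
rewrite big_split /= (bigD1 i) //= [X in _ + X = _](bigD1 m) //=.
rewrite !big1 ?addr0 ?eqxx // => u /negPf ->; by rewrite /= !mul0r.
Qed.

(** The vector [i] is braided with [m] and then with [M]. Only [p = m] and [p = i] contribute, so
    the identity reduces to comparing two terms according to the position of [s]. *)
Lemma braid1_natural n (i m : 'I_n) (M : {set 'I_n}) s (S' : {set 'I_n}) :
  \sum_(p in S') z ^+ above S' p *
    \sum_u braid11 i m u p * braid1 z u M s (S' :\ p)
  = (m \notin M)%:R * z ^+ above M m * braid1 z i (m |: M) s S'.
Proof.
transitivity (
  (m \in S')%:R * (z ^+ above S' m * (if i == m then - z else 1) * braid1 z i M s (S' :\ m))
  + ((i \in S') && (m < i)%N)%:R * (z ^+ above S' i * (z^-1 - z) * braid1 z m M s (S' :\ i))).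
  under eq_bigr => p _ do rewrite braid11_sum mulrDr.
  rewrite big_split big_mkcond [X in _ + X = _]big_mkcond /=.
  rewrite (bigD1 m) //= [X in _ + X = _](bigD1 i) //= !eqxx.
  rewrite !big1 ?addr0; first last.
  - by move=> p /negPf ->; rewrite !mul0r mulr0 if_same.
  - by move=> p /negPf ->; rewrite !mul0r mulr0 if_same.
  congr (_ + _).
    by case: ifP; rewrite ?mul0r ?mul1r ?mulrA.
  by case: ifP => _; case: (m < i)%N => /=; rewrite ?mul0r ?mulr0 //; ring.
rewrite /braid1.
transitivity (
  ((m \in move i s S') && (M == move i s S' :\ m))%:R * z ^+ above M m * move_wt z i s S'); last first.
  have -> : ((m \in move i s S') && (M == move i s S' :\ m)) =
     ((m \notin M) && (m |: M == move i s S')).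
    apply/andP/andP => -[].
      by move=> mX /eqP ->; rewrite !inE eqxx setD1K.
    by move=> mM /eqP <-; rewrite setU11 setU1K.
  by rewrite -mulnb natrM; ring.
rewrite /move_wt /move.
have [->{s}|si] := eqVneq s i.
  have [<-{m}|im] := eqVneq i m.
    rewrite ltnn !inE eqxx andbF /= mul0r addr0.
    have [iS|_] := boolP (i \in S'); last by rewrite !mul0r.
    have [->|_] := eqVneq M (S' :\ i); last by rewrite !(mul0r, mulr0).
    by rewrite (aboveD1 _ i) ltnn andbF add0n /=; ring.
  rewrite !inE im /=.
  rewrite [X in _ + X](_ : _ = 0); last first.
    by have [mi|im'] := ltnP m i; rewrite ?andbF ?mul0r // ltnNge ltnW //= !mulr0.
  rewrite addr0.
  have [mS|_] := boolP (m \in S'); last by rewrite !mul0r.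
  have [->|_] := eqVneq M (S' :\ m); last by rewrite !(mul0r, mulr0).
  by rewrite (aboveD1 _ m) ltnn andbF add0n /=; case: ifP => _; ring.
have [<-{m}|im] := eqVneq i m.
  by rewrite ltnn !inE eqxx [i == s]eq_sym (negPf si) !andbF /= !(mul0r, mulr0) addr0.
have [->{s si}|sm] := eqVneq s m.
  rewrite !inE eqxx [m == i]eq_sym im /= mulr1.
  have [mi|im'] := ltnP m i; last by rewrite /= !(andbF, mulr0, mul0r) addr0.
  have [iS|iS] := boolP (i \in S'); last by rewrite /= !(andbF, mulr0, mul0r) addr0.
  have aE := above_split S' mi; rewrite iS in aE.
  have [mS|mS] := boolP (m \in S') => /=.
    have -> : m |: S' :\ m :\ i = S' :\ i.
      by apply/setP => a; rewrite !inE; case: (a =P m) => // ->; rewrite mS eq_sym im.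
    have := betweenD1 S' m m i; rewrite ltnn andbF add0n => <-.
    rewrite aE !exprD; field.
    by rewrite z_neq0 expf_neq0.
  rewrite setU1K; last by rewrite !inE negb_and mS orbT.
  have [->|_] := eqVneq M (S' :\ i); last by rewrite !(mul0r, mulr0, addr0).
  have := aboveD1 S' i m; rewrite iS mi aE /= addnAC addnC => /addnI <-.
  rewrite !exprD; field.
  by rewrite ?z_neq0 ?expf_neq0.
(* Here [s], [i], [m] are distinct. A nonzero term needs [i] and [m] in [S'] and [s] outside it, and
   all terms then carry the same set [M]. Both terms on the left survive only for [s < m < i]. *)
rewrite !inE (negPf sm) [m == s]eq_sym (negPf sm) [m == i]eq_sym im (negPf si) /=.
have [iS|iS] := boolP (i \in S'); last by rewrite /= !(andbF, mulr0, mul0r) addr0.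
have [mS|mS] := boolP (m \in S'); last by rewrite /= !(andbF, mulr0, mul0r) addr0.
have [sS|sS] := boolP (s \in S'); first by rewrite /= !(andbF, mulr0, mul0r) addr0.
have -> : s |: S' :\ i :\ m = s |: S' :\ m :\ i.
  by apply/setP => a; rewrite !inE; case: (a == i); rewrite ?andbF ?andbT.
have -> : (s |: S' :\ i) :\ m = s |: S' :\ m :\ i.
  apply/setP => a; rewrite !inE; case: (a =P s) => [->|_]; rewrite ?sm //=.
  by case: (a == i); rewrite ?andbF ?andbT.
have [->|_] := eqVneq M (s |: S' :\ m :\ i); last by rewrite !(mul0r, mulr0, addr0).
rewrite aboveU1 ?inE ?negb_and ?sS ?orbT //=.
have := aboveD1 S' m m; rewrite ltnn andbF add0n => ->.
have := betweenD1 S' m s i; rewrite mS /= => ->.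
have := aboveD1 (S' :\ m) i m; rewrite !inE im iS /= => ->.
have [ms|sm'|/val_inj e] := ltngtP m s; last by rewrite e eqxx in sm.
  have [si'|is'] := ltnP s i; last by rewrite /= !(andbF, mulr0, mul0r) addr0.
  by rewrite (ltn_trans ms si') /=; ring.
have [mi|im'|/val_inj e] := ltngtP m i; last by rewrite e eqxx in im.
  rewrite (ltn_trans sm' mi) /= !mul1r add0n.
  have e1 := @above_split _ (S' :\ m) m i mi.
  have e2 := aboveD1 (S' :\ m) i m.
  have e3 := aboveD1 S' m i.
  have e4 := @between_split _ (S' :\ m) s m i; rewrite sm' mi in e4.
  have e5 := betweenD1 S' i s m.
  have e6 := betweenD1 S' m s m.
  move: e2 e3 e4 e5 e6; rewrite e1 !inE eqxx im iS mS mi ltnn ltnNge (ltnW mi) !andbF /=.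
  rewrite !add0n addn0 => e2 e3 /(_ isT) -> <- ->.
  have -> : above (S' :\ m :\ i) m = (between (S' :\ m) m i + above S' i)%N by lia.
  rewrite !exprD; field.
  by rewrite ?z_neq0 ?expf_neq0.
have -> : between (S' :\ m) s i = between S' s i.
  by have := betweenD1 S' m s i; rewrite sm' ltnNge (ltnW im') andbF add0n.
by rewrite /= !mul0r addr0; case: ifP => _; ring.
Qed.

End RankOneBraiding.

(** * Induction on finite sets and reindexing of sums over sets *)

Lemma sorted_val_enum n (I : {set 'I_n}) : sorted <%O (map val (enum I)).
Proof.
rewrite sorted_map /enum_mem -enumT; apply: sorted_filter => [a b c|].
  exact: ltn_trans.
by have := iota_ltn_sorted 0 n; rewrite -val_enum_ord sorted_map.
Qed.

Lemma finset_ind (T : finType) (P : {set T} -> Prop) :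
  P set0 -> (forall x (A : {set T}), x \notin A -> P A -> P (x |: A)) -> forall A, P A.
Proof.
move=> P0 PU A; have [m] := ubnP #|A|; elim: m A => // m IHm A.
have [->//|[x xA]] := set_0Vmem A; rewrite (cardsD1 x) xA => /IHm PA.
by rewrite -(setD1K xA); apply: PU => //; rewrite !inE eqxx.
Qed.

Section SetSums.
Context (n : nat) (V : nmodType).

(** The bijection [(S, p) -> (S :\ p, p)] passes from the removals in the naturality identities to
    the insertions in [minor_insert], and back. *)
Lemma sum_setD1 (F : {set 'I_n} -> 'I_n -> {set 'I_n} -> V) :
  \sum_(S : {set 'I_n}) \sum_(p in S) F S p (S :\ p) =
  \sum_(S : {set 'I_n}) \sum_(p | p \notin S) F (p |: S) p S.
Proof.
rewrite (exchange_big_dep xpredT) //= [RHS](exchange_big_dep xpredT) //=.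
apply: eq_bigr => p _.
rewrite (reindex_onto (fun S => p |: S) (fun S => S :\ p)) /=; last first.
  by move=> S pS; rewrite setD1K.
apply: eq_big => [S|S /andP[_ /eqP ->] //].
rewrite setU11 /=; apply/eqP/idP => [<-|/setU1K //].
by rewrite !inE eqxx.
Qed.

Lemma sum_pairs (J : {set 'I_n}) (F : 'I_n -> 'I_n -> V) :
  \sum_(j in J) \sum_(m in J :\ j) F j m =
  \sum_(j in J) \sum_(m in J | (m < j)%N) (F j m + F m j).
Proof.
under [RHS]eq_bigr => j _ do rewrite big_split.
rewrite big_split /= [X in _ = _ + X](exchange_big_dep (mem J)) /=; last by move=> ? ? ? /andP[].
rewrite -big_split; apply: eq_bigr => j jJ /=.
rewrite (bigID (fun m : 'I_n => (m < j)%N)) /=; congr (_ + _); apply: eq_bigl => m.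
  by rewrite !inE -andbA; case: eqP => [->|_]; rewrite ?ltnn ?andbF.
rewrite !inE jJ -leqNgt leq_eqVlt andbC.
have [->|mj] := eqVneq m j; first by rewrite ltnn !andbF.
by rewrite /= [val j == _]eq_sym (inj_eq val_inj) (negPf mj) andbC.
Qed.

End SetSums.

(** * Minors as iterated row expansions *)

Section Minors.
Context (k : fieldType) (n : nat) (q : k) (q_neq0 : q != 0).
Context (A : algType k) (x : 'I_n -> 'I_n -> A) (xP : qmx_relations q x).

Let z := - q.

(* The last row of the minor comes first in the word [w]. *)
Fixpoint word_minor (w : seq 'I_n) (J : {set 'I_n}) : A :=
  if w is i :: w' then
    \sum_(j in J) z ^+ above J j *: (word_minor w' (J :\ j) * x i j)
  else (J == set0)%:R.

(** With the columns [m < j] grouped, the dependence on the rows [a] and [b] is confined to a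
    two-by-two expression. *)
Lemma word_minor2 a b w J :
  word_minor (a :: b :: w) J = \sum_(j in J) \sum_(m in J | (m < j)%N)
    z ^+ (above J j + above (J :\ j) m) *:
     (word_minor w (J :\ j :\ m) * (x b m * x a j + z *: (x b j * x a m))).
Proof.
rewrite /= (eq_bigr (fun j => \sum_(m in J :\ j) z ^+ (above J j + above (J :\ j) m) *:
   (word_minor w (J :\ j :\ m) * (x b m * x a j)))); last first.
  move=> j _; rewrite mulr_suml scaler_sumr; apply: eq_bigr => m _.
  by rewrite -scalerAl scalerA -exprD -mulrA.
rewrite sum_pairs; apply: eq_bigr => j jJ; apply: eq_bigr => m /andP[mJ mj].
have -> : (above J m + above (J :\ m) j)%N = (above J j + above (J :\ j) m).+1.
  have := aboveD1 J j m; have := aboveD1 J m j.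
  by rewrite jJ mJ mj ltnNge (ltnW mj) /= => -> ->; rewrite add0n add1n addSn addnC.
have -> : J :\ m :\ j = J :\ j :\ m by rewrite !setDDl setUC.
by rewrite mulrDr scalerDr -scalerAr scalerA -exprSr.
Qed.

Lemma word_minor_eq i w J : word_minor (i :: i :: w) J = 0.
Proof.
rewrite word_minor2; apply: big1 => j _; apply: big1 => m /andP[_ mj].
case: xP => _ row _ _; rewrite (row _ _ _ mj) -scalerDl subrr scale0r.
by rewrite mulr0 scaler0.
Qed.

(** The two-by-two expressions agree by the commuting and crossing relations, because
    [z * qhat q + z ^+ 2 = 1]. *)
Lemma word_minor_swap (i l : 'I_n) w J : (i < l)%N ->
  word_minor (i :: l :: w) J = z *: word_minor (l :: i :: w) J.
Proof.
move=> il; rewrite !word_minor2 scaler_sumr; apply: eq_bigr => j _.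
rewrite scaler_sumr; apply: eq_bigr => m /andP[_ mj].
rewrite [RHS]scalerA [z * _]mulrC -[RHS]scalerA; congr (_ *: _).
rewrite [RHS]scalerAr; congr (_ * _).
case: xP => _ _ comm cross.
have /(canRL (subrK _)) -> := cross _ _ _ _ il mj.
rewrite (comm _ _ _ _ il mj) !scalerDr !scalerA addrAC -scalerDl; congr (_ + _).
by rewrite -[LHS]scale1r /z /qhat; congr (_ *: _); field.
Qed.

Fixpoint insert_desc (s : 'I_n) (w : seq 'I_n) : seq 'I_n :=
  if w is m :: w' then if (s < m)%N then m :: insert_desc s w' else s :: w
  else [:: s].

Definition desc (w : seq 'I_n) := sorted (fun a b : 'I_n => (b < a)%N) w.

Lemma desc_trans : transitive (fun a b : 'I_n => (b < a)%N).
Proof. by move=> a b c ab ca; apply: ltn_trans ca ab. Qed.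

Lemma desc_cons m w : desc (m :: w) -> desc w /\ forall a, a \in w -> (a < m)%N.
Proof.
rewrite /desc /= path_sortedE; last exact: desc_trans.
by case/andP => /allP lt_m ->; split.
Qed.

Lemma mem_insert_desc s w : insert_desc s w =i s :: w.
Proof.
elim: w => [|m w IHw] //= a; case: ifP => _ //.
by rewrite inE IHw !inE orbCA.
Qed.

Lemma desc_insert s w : desc w -> s \notin w -> desc (insert_desc s w).
Proof.
elim: w => [|m w IHw] //= /[dup] mw /desc_cons[/IHw{}IHw lt_m].
rewrite inE negb_or => /andP[sm /IHw{}IHw]; case: ltnP => ms.
  rewrite /desc /= path_sortedE ?[sorted _ _]IHw ?andbT; last exact: desc_trans.
  by apply/allP => a; rewrite mem_insert_desc inE => /predU1P[->//|/lt_m].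
by rewrite /desc /= ltn_neqAle eq_sym [val s == _](inj_eq val_inj) sm ms.
Qed.

(** Insertion sort: each larger letter passed costs one factor [z], and a repeated letter meets its
    copy, where the minor vanishes. *)
Lemma word_minor_insert s w J : desc w ->
  word_minor (s :: w) J =
    if s \in w then 0
    else z ^+ count (fun a : 'I_n => (s < a)%N) w *: word_minor (insert_desc s w) J.
Proof.
elim: w J => [|m w IHw] J; first by rewrite scale1r.
move=> /desc_cons[/IHw{}IHw lt_m].
have [->|sm] := eqVneq s m; first by rewrite word_minor_eq mem_head.
rewrite inE (negPf sm) /=.
have [ms|ms] := ltnP s m.
  rewrite [LHS]word_minor_swap // /=; case: ifP IHw => _ IHw.
    rewrite big1 ?scaler0 // => j _.
    by rewrite -/(word_minor (s :: w) (J :\ j)) IHw mul0r scaler0.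
  rewrite exprS -scalerA; congr (_ *: _); rewrite scaler_sumr.
  apply: eq_bigr => j _; rewrite -/(word_minor (s :: w) (J :\ j)) IHw.
  by rewrite -scalerAl !scalerA mulrC.
case: ifP => [/lt_m sm'|_]; first by rewrite ltnNge ms in sm'.
rewrite (_ : count _ w = 0%N) ?scale1r //; apply/eqP; rewrite -leqn0 leqNgt -has_count.
apply/hasPn => a /lt_m am; rewrite -leqNgt ltnW //; exact: leq_trans am ms.
Qed.

Definition minor (I J : {set 'I_n}) : A := word_minor (rev (enum I)) J.

Lemma desc_rev_enum (I : {set 'I_n}) : desc (rev (enum I)).
Proof. by have := sorted_val_enum I; rewrite sorted_map /desc rev_sorted. Qed.

(** Expansion along a row [s] that need not be the last one. The factor is the one in the naturality
    identities, which is what lets the inductions below close. *)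
Lemma minor_insert (S J : {set 'I_n}) (s : 'I_n) :
  \sum_(j in J) z ^+ above J j *: (minor S (J :\ j) * x s j) =
  (s \notin S)%:R * z ^+ above S s *: minor (s |: S) J.
Proof.
rewrite -/(word_minor (s :: rev (enum S)) J) word_minor_insert ?desc_rev_enum //.
rewrite mem_rev mem_enum; case: ifPn => sS; first by rewrite mul0r scale0r.
rewrite mul1r; congr (_ *: word_minor _ J).
  rewrite count_rev -size_filter /above cardE /enum_mem -filter_predI.
  by congr (z ^+ size _); apply: eq_filter => a; rewrite !inE andbC.
apply: (sorted_eq desc_trans _ _ (desc_rev_enum _)).
- by move=> a b /andP[ab /ltnW]; rewrite leqNgt ab.
- by apply: desc_insert; rewrite ?desc_rev_enum // mem_rev mem_enum.
- apply: uniq_perm; rewrite ?rev_uniq ?enum_uniq //.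
    apply: (sorted_uniq desc_trans); first by move=> a; rewrite ltnn.
    by apply: desc_insert; rewrite ?desc_rev_enum // mem_rev mem_enum.
  by move=> a; rewrite mem_insert_desc inE !mem_rev !mem_enum !inE.
Qed.

(** * The braiding intertwines products of minors *)

Lemma sum_indicator2 (a b : 'I_n) (P : 'I_n -> 'I_n -> bool)
    (G : 'I_n -> 'I_n -> k) (F : 'I_n -> 'I_n -> A) :
  (forall u p, P u p = (u == a) && (p == b)) ->
  \sum_p \sum_u ((P u p)%:R * G u p) *: F u p = G a b *: F a b.
Proof.
move=> PE; under eq_bigr => p _ do under eq_bigr => u _ do rewrite PE.
rewrite (bigD1 b) //= [X in _ + X]big1 => [|p /negPf pb]; last first.
  by apply: big1 => u _; rewrite pb andbF mul0r scale0r.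
rewrite addr0 (bigD1 a) //= !eqxx mul1r big1 ?addr0 // => u /negPf ->.
by rewrite mul0r scale0r.
Qed.

(** The defining relations in R-matrix form; the case analysis on the orders of [i], [m] and of [t],
    [n'] recovers each of them. *)
Lemma gen_comm (i m t n' : 'I_n) :
  \sum_p \sum_u braid11 z i m u p *: (x u t * x p n') =
  \sum_r \sum_v braid11 z v r t n' *: (x m r * x i v).
Proof.
have qE : q = - z by rewrite /z opprK.
have z0 : z != 0 by rewrite oppr_eq0.
have cE : z^-1 - z = qhat q by rewrite /qhat qE invrN opprK addrC.
under eq_bigr => p _.
  under eq_bigr => u _ do rewrite /braid11 scalerDl.
  rewrite big_split; over.
under [RHS]eq_bigr => r _.
  under eq_bigr => v _ do rewrite /braid11 scalerDl.
  rewrite big_split; over.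
rewrite !big_split /=.
rewrite (@sum_indicator2 i m _ (fun _ _ => if i == m then - z else 1) (fun u p => x u t * x p n')) //.
rewrite (@sum_indicator2 m i _ (fun _ _ => (m < i)%N%:R * (z^-1 - z)) (fun u p => x u t * x p n')) //.
rewrite (@sum_indicator2 t n' _ (fun v r => if v == r then - z else 1) (fun v r => x m r * x i v)); last first.
  by move=> u p; rewrite [t == u]eq_sym [n' == p]eq_sym.
rewrite (@sum_indicator2 n' t _ (fun v r => (r < v)%N%:R * (z^-1 - z)) (fun v r => x m r * x i v)); last first.
  by move=> u p; rewrite [t == p]eq_sym [n' == u]eq_sym andbC.
rewrite cE -qE; case: xP => col row comm cross.
have [<-{m}|im] := eqVneq i m; have [<-{n'}|tn] := eqVneq t n'; rewrite ?ltnn ?mul0r ?scale0r ?addr0 //.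
- have [tn'|nt|/val_inj/eqP] := ltngtP t n'; last by rewrite (negPf tn).
    rewrite (row _ _ _ tn') !scalerA -scalerDl mul1r /qhat; congr (_ *: _).
    by field.
  by rewrite (row _ _ _ nt) scale1r mul0r scale0r addr0.
- have [mi|im'|/val_inj/eqP] := ltngtP m i; last by rewrite eq_sym (negPf im).
    rewrite (col _ _ _ mi) !scalerA -scalerDl mul1r /qhat; congr (_ *: _).
    by field.
  by rewrite (col _ _ _ im') scale1r mul0r scale0r addr0.
rewrite !scale1r.
have [mi|im'|/val_inj/eqP] := ltngtP m i; last by rewrite eq_sym (negPf im).
  have [tn'|nt|/val_inj/eqP] := ltngtP t n'; last by rewrite (negPf tn).
    by rewrite (comm _ _ _ _ mi tn').
  rewrite mul1r mul0r scale0r addr0 -(cross _ _ _ _ mi nt).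
  by rewrite addrC subrK.
have [tn'|nt|/val_inj/eqP] := ltngtP t n'; last by rewrite (negPf tn).
  rewrite mul1r mul0r scale0r addr0 -(comm _ _ _ _ im' tn') -(cross _ _ _ _ im' tn').
  by rewrite addrC subrK.
by rewrite !mul0r !scale0r !addr0 (comm _ _ _ _ im' nt).
Qed.

Lemma minor_set0 (J : {set 'I_n}) : minor set0 J = (J == set0)%:R.
Proof. by rewrite /minor enum_set0. Qed.

Lemma braid1_set0 (i s : 'I_n) (S : {set 'I_n}) :
  braid1 z i set0 s S = ((s == i) && (S == set0))%:R.
Proof.
rewrite /braid1 /move /move_wt eq_sym; have [_|si] := eqVneq s i.
  by have [->|] := eqVneq S set0; rewrite ?inE ?mulr1 ?mul0r.
suff /negPf -> : s |: S :\ i != set0 by rewrite mul0r.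
by apply/set0Pn; exists s; rewrite setU11.
Qed.

(** Induction on [M]: a row is split off the minor, the generator is moved past the smaller minor by
    induction and past the row by [gen_comm], and the minor is reassembled. *)
Lemma gen_minor_braid (M N : {set 'I_n}) (i j : 'I_n) :
  \sum_S' \sum_s braid1 z i M s S' *: (x s j * minor S' N) =
  \sum_N' \sum_t braid1 z t N' j N *: (minor M N' * x i t).
Proof.
have z0 : z != 0 by rewrite oppr_eq0.
elim/finset_ind: M N i j => [|m M mM IHM] N i j.
  rewrite (bigD1 set0) //= [X in _ + X]big1 ?addr0; last first.
    by move=> S /negPf S0; apply: big1 => s _; rewrite braid1_set0 S0 andbF scale0r.
  rewrite (bigD1 i) //= big1 ?addr0; last first.
    by move=> s /negPf si; rewrite braid1_set0 si scale0r.
  rewrite [RHS](bigD1 set0) //= [X in _ = _ + X]big1 ?addr0; last first.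
    by move=> S /negPf S0; apply: big1 => s _; rewrite minor_set0 S0 mul0r scaler0.
  rewrite [RHS](bigD1 j) //= [X in _ = _ + X]big1 ?addr0; last first.
    by move=> s /negPf si; rewrite braid1_set0 eq_sym si scale0r.
  rewrite !braid1_set0 !minor_set0 !eqxx scale1r mul1r.
  by case: (N == set0); rewrite ?mulr1 ?mulr0 ?scale1r ?scale0r.
(* This invertible factor is the one that naturality and [minor_insert] attach to the insertion of
   [m] into [M]. *)
apply: (scalerI (expf_neq0 (above M m) z0)).
transitivity (\sum_(S' : {set 'I_n}) \sum_(p in S') \sum_s \sum_u
    (z ^+ above S' p * (braid11 z i m u p * braid1 z u M s (S' :\ p))) *:
    (x s j * minor S' N)).
  rewrite scaler_sumr; apply: eq_bigr => S' _.
  rewrite exchange_big scaler_sumr; apply: eq_bigr => s _.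
  have := braid1_natural z0 i m M s S'; rewrite mM mul1r scalerA => <-.
  rewrite scaler_suml; apply: eq_bigr => p _; rewrite mulr_sumr scaler_suml.
  by [].
transitivity (\sum_(S : {set 'I_n}) \sum_(p | p \notin S) \sum_s \sum_u
    (z ^+ above S p * (braid11 z i m u p * braid1 z u M s S)) *:
    (x s j * minor (p |: S) N)).
  rewrite -(sum_setD1 (fun S p S0 => \sum_s \sum_u
    (z ^+ above S0 p * (braid11 z i m u p * braid1 z u M s S0)) *:
    (x s j * minor S N))).
  apply: eq_bigr => S _; apply: eq_bigr => p _.
  by rewrite (aboveD1 S p p) ltnn andbF.
(* The condition [p \notin S] disappears because the row expansion is zero for [p] in [S]. *)
transitivity (\sum_(n' in N) \sum_p \sum_u (z ^+ above N n' * braid11 z i m u p) *: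
  ((\sum_S \sum_s braid1 z u M s S *: (x s j * minor S (N :\ n'))) * x p n')).
  transitivity (\sum_(S : {set 'I_n}) \sum_p \sum_s \sum_u 
    (braid11 z i m u p * braid1 z u M s S) *:
    (x s j * \sum_(n' in N) z ^+ above N n' *: (minor S (N :\ n') * x p n'))).
    apply: eq_bigr => S _; rewrite big_mkcond; apply: eq_bigr => p _.
    case: ifP => pS.
      apply: eq_bigr => s _; apply: eq_bigr => u _.
      rewrite minor_insert pS mul1r -scalerAr scalerA; congr (_ *: _).
      by rewrite mulrC.
    rewrite big1 // => s _; rewrite big1 // => u _.
    by rewrite minor_insert pS mul0r scale0r mulr0 scaler0.
  rewrite exchange_big [RHS]exchange_big; apply: eq_bigr => p _ /=.
  under eq_bigr => S _ do rewrite exchange_big /=.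
  rewrite exchange_big [RHS]exchange_big; apply: eq_bigr => u _ /=.
  under [RHS]eq_bigr => n' _ do rewrite mulr_suml scaler_sumr.
  rewrite [RHS]exchange_big; apply: eq_bigr => S _ /=.
  under [RHS]eq_bigr => n' _ do rewrite mulr_suml scaler_sumr.
  rewrite [RHS]exchange_big; apply: eq_bigr => s _ /=.
  rewrite mulr_sumr scaler_sumr; apply: eq_bigr => n' _.
  rewrite -scalerAr -scalerAl !scalerA.
  by congr (_ *: _); [ring | rewrite mulrA].
transitivity (\sum_N0 \sum_r \sum_v (\sum_(n' in N) z ^+ above N n' *
    \sum_t braid11 z v r t n' * braid1 z t N0 j (N :\ n')) *:
   (minor M N0 * (x m r * x i v))).
  transitivity (\sum_N0 \sum_(n' in N) \sum_t
      (z ^+ above N n' * braid1 z t N0 j (N :\ n')) *: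
      (minor M N0 * \sum_p \sum_u braid11 z i m u p *: (x u t * x p n'))).
    rewrite [RHS]exchange_big; apply: eq_bigr => n' _ /=.
    under [RHS]eq_bigr => N0 _.
      under eq_bigr => t _ do rewrite mulr_sumr scaler_sumr.
      rewrite exchange_big /=; over.
    rewrite [RHS]exchange_big; apply: eq_bigr => p _ /=.
    under [RHS]eq_bigr => N0 _.
      under eq_bigr => t _ do rewrite mulr_sumr scaler_sumr.
      rewrite exchange_big /=; over.
    rewrite [RHS]exchange_big; apply: eq_bigr => u _ /=.
    rewrite IHM mulr_suml scaler_sumr; apply: eq_bigr => N0 _.
    rewrite mulr_suml scaler_sumr; apply: eq_bigr => t _.
    rewrite -scalerAr -scalerAl !scalerA.
    by congr (_ *: _); [ring | rewrite mulrA].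
  apply: eq_bigr => N0 _.
  under eq_bigr => n' _.
    under eq_bigr => t _ do rewrite gen_comm mulr_sumr scaler_sumr.
    rewrite exchange_big /=; over.
  rewrite exchange_big; apply: eq_bigr => r _ /=.
  under eq_bigr => n' _.
    under eq_bigr => t _ do rewrite mulr_sumr scaler_sumr.
    rewrite exchange_big /=; over.
  rewrite exchange_big; apply: eq_bigr => v _ /=.
  rewrite scaler_suml; apply: eq_bigr => n' _.
  rewrite mulr_sumr scaler_suml; apply: eq_bigr => t _.
  by rewrite -scalerAr scalerA; congr (_ *: _); ring.
(* The same naturality identity, now applied to the column sets. *)
transitivity (\sum_(N0 : {set 'I_n}) \sum_(r | r \notin N0) \sum_v
   (z ^+ above (r |: N0) r * braid1 z v (r |: N0) j N) *: (minor M N0 * (x m r * x i v))).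
  apply: eq_bigr => N0 _; rewrite [RHS]big_mkcond; apply: eq_bigr => r _.
  rewrite (aboveD1 (r |: N0) r r) ltnn andbF.
  case: ifPn => rN.
    by apply: eq_bigr => v _; rewrite braid1_natural // rN mul1r setU1K.
  by rewrite big1 // => v _; rewrite braid1_natural // (negPf rN) !mul0r scale0r.
rewrite -(sum_setD1 (fun N1 r N0 => \sum_v
   (z ^+ above N1 r * braid1 z v N1 j N) *: (minor M N0 * (x m r * x i v)))).
rewrite scaler_sumr; apply: eq_bigr => N1 _ /=.
rewrite exchange_big scaler_sumr; apply: eq_bigr => v _ /=.
have := minor_insert M N1 m; rewrite mM mul1r scalerA [z ^+ _ * _]mulrC -scalerA scalerAl => <-.
rewrite mulr_suml scaler_sumr; apply: eq_bigr => r _.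
rewrite -scalerAl !scalerA.
by congr (_ *: _); [ring | rewrite mulrA].
Qed.

Lemma braid_set0 (M S S' : {set 'I_n}) :
  braid z 0 set0 M S S' = ((S == set0) && (S' == M))%:R.
Proof.
rewrite /braid cards0 subr0 add0r; have [->|S0] := eqVneq S set0; last first.
  by rewrite eqz_nat cards_eq0 (negPf S0) mul0r.
rewrite cards0 eqxx mul1r /=.
have hE p : height 0 set0 set0 p = 0 :> int by rewrite /height subrr.
have [->|/eqP SM] := eqVneq S' M.
  by apply: big1 => p _; rewrite hE inE /=; case: (p \in M).
have /existsP[p] : [exists p, (p \in S') != (p \in M)].
  apply: contra_notT SM => /existsPn H; apply/setP => p; apply/eqP.
  by rewrite -[_ == _]negbK H.
by rewrite (bigD1 p) //= hE inE; case: (p \in S'); case: (p \in M); rewrite //= mul0r.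
Qed.

(** Induction on [I], with naturality in the first factor and [gen_minor_braid] in the role of
    [gen_comm]. *)
Lemma minor_braid (I M J N : {set 'I_n}) :
  \sum_S \sum_S' braid z 0 I M S S' *: (minor S J * minor S' N) =
  \sum_T \sum_T' braid z 0 T T' J N *: (minor M T' * minor I T).
Proof.
have z0 : z != 0 by rewrite oppr_eq0.
elim/finset_ind: I M J N => [|i I iI IHI] M J N.
  rewrite (bigD1 set0) //= [X in _ + X]big1 ?addr0; last first.
    by move=> S /negPf S0; apply: big1 => s _; rewrite braid_set0 S0 scale0r.
  rewrite (bigD1 M) //= big1 ?addr0; last first.
    by move=> s /negPf si; rewrite braid_set0 si andbF scale0r.
  rewrite [RHS](bigD1 set0) //= [X in _ = _ + X]big1 ?addr0; last first.
    by move=> S /negPf S0; apply: big1 => s _; rewrite minor_set0 S0 mulr0 scaler0.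
  rewrite [RHS](bigD1 N) //= [X in _ = _ + X]big1 ?addr0; last first.
    by move=> s /negPf si; rewrite braid_set0 [N == s]eq_sym si andbF scale0r.
  rewrite !braid_set0 !minor_set0 !eqxx andbT scale1r mulr1.
  by case: (J == set0); rewrite ?mul1r ?mul0r ?scale1r ?scale0r.
apply: (scalerI (expf_neq0 (above I i) z0)).
transitivity (\sum_(S : {set 'I_n}) \sum_(s in S) \sum_S' \sum_M'
    (z ^+ above S s * (braid z 0 I M (S :\ s) M' * braid1 z i M' s S')) *:
    (minor S J * minor S' N)).
  rewrite scaler_sumr; apply: eq_bigr => S _.
  rewrite exchange_big scaler_sumr; apply: eq_bigr => S' _ /=.
  have := braid_natural z0 I M S S' i; rewrite iI mul1r scalerA => <-.
  rewrite scaler_suml; apply: eq_bigr => p _; rewrite mulr_sumr scaler_suml.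
  by [].
transitivity (\sum_(S : {set 'I_n}) \sum_(s | s \notin S) \sum_S' \sum_M'
    (z ^+ above S s * (braid z 0 I M S M' * braid1 z i M' s S')) *:
    (minor (s |: S) J * minor S' N)).
  rewrite -(sum_setD1 (fun S s S0 => \sum_S' \sum_M'
    (z ^+ above S0 s * (braid z 0 I M S0 M' * braid1 z i M' s S')) *:
    (minor S J * minor S' N))).
  apply: eq_bigr => S _; apply: eq_bigr => p _.
  by rewrite (aboveD1 S p p) ltnn andbF.
transitivity (\sum_(j in J) \sum_S \sum_M' (z ^+ above J j * braid z 0 I M S M') *:
  (minor S (J :\ j) * (\sum_S' \sum_s braid1 z i M' s S' *: (x s j * minor S' N)))).
  transitivity (\sum_(S : {set 'I_n}) \sum_s \sum_S' \sum_M' 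
    (braid z 0 I M S M' * braid1 z i M' s S') *:
    ((\sum_(j in J) z ^+ above J j *: (minor S (J :\ j) * x s j)) * minor S' N)).
    apply: eq_bigr => S _; rewrite big_mkcond; apply: eq_bigr => s _.
    case: ifP => sS.
      apply: eq_bigr => S' _; apply: eq_bigr => M' _.
      rewrite minor_insert sS mul1r -scalerAl scalerA; congr (_ *: _).
      by rewrite mulrC.
    rewrite big1 // => S' _; rewrite big1 // => M' _.
    by rewrite minor_insert sS mul0r scale0r mul0r scaler0.
  rewrite [RHS]exchange_big; apply: eq_bigr => S _ /=.
  rewrite exchange_big /=.
  under eq_bigr => S' _ do rewrite exchange_big /=.
  rewrite exchange_big /=.
  rewrite [RHS]exchange_big; apply: eq_bigr => M' _ /=.
  under [RHS]eq_bigr => j _ do rewrite mulr_sumr scaler_sumr.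
  rewrite [RHS]exchange_big; apply: eq_bigr => S' _ /=.
  under [RHS]eq_bigr => j _ do rewrite mulr_sumr scaler_sumr.
  rewrite [RHS]exchange_big; apply: eq_bigr => s _ /=.
  rewrite mulr_suml scaler_sumr; apply: eq_bigr => j _.
  rewrite -scalerAr -scalerAl !scalerA.
  by congr (_ *: _); [ring | rewrite mulrA].
(* The split-off row passes the second minor by [gen_minor_braid], and then the rest of the first
   minor passes it by induction. *)
transitivity (\sum_T \sum_t \sum_N1 (\sum_(j in J) z ^+ above J j *
    \sum_N' braid z 0 T N1 (J :\ j) N' * braid1 z t N' j N) *:
   (minor M N1 * (minor I T * x i t))).
  transitivity (\sum_(j in J) \sum_N' \sum_t (z ^+ above J j * braid1 z t N' j N) *:
      ((\sum_S \sum_M' braid z 0 I M S M' *: (minor S (J :\ j) * minor M' N')) * x i t)).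
    apply: eq_bigr => j _.
    under eq_bigr => S _.
      under eq_bigr => M' _ do rewrite gen_minor_braid mulr_sumr scaler_sumr.
      rewrite exchange_big /=; over.
    rewrite exchange_big; apply: eq_bigr => N' _ /=.
    under eq_bigr => S _.
      under eq_bigr => M' _ do rewrite mulr_sumr scaler_sumr.
      rewrite exchange_big /=; over.
    rewrite exchange_big; apply: eq_bigr => t _ /=.
    rewrite mulr_suml scaler_sumr; apply: eq_bigr => S _.
    rewrite mulr_suml scaler_sumr; apply: eq_bigr => M' _.
    rewrite -scalerAr -scalerAl !scalerA.
    by congr (_ *: _); [ring | rewrite mulrA].
  under eq_bigr => j _.
    under eq_bigr => N' _.
      under eq_bigr => t _ do rewrite IHI mulr_suml scaler_sumr.
      rewrite exchange_big /=; over.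
    rewrite exchange_big /=; over.
  rewrite exchange_big; apply: eq_bigr => T _ /=.
  under eq_bigr => j _ do rewrite exchange_big /=.
  rewrite exchange_big; apply: eq_bigr => t _ /=.
  under eq_bigr => j _.
    under eq_bigr => N' _ do rewrite mulr_suml scaler_sumr.
    rewrite exchange_big /=; over.
  rewrite exchange_big; apply: eq_bigr => N1 _ /=.
  rewrite scaler_suml; apply: eq_bigr => j _.
  rewrite mulr_sumr scaler_suml; apply: eq_bigr => N' _.
  rewrite -scalerAl scalerA.
  by congr (_ *: _); [ring | rewrite mulrA].
transitivity (\sum_(T0 : {set 'I_n}) \sum_(t | t \notin T0) \sum_N1
   (z ^+ above (t |: T0) t * braid z 0 (t |: T0) N1 J N) *: (minor M N1 * (minor I T0 * x i t))).
  apply: eq_bigr => T0 _; rewrite [RHS]big_mkcond; apply: eq_bigr => t _.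
  rewrite (aboveD1 (t |: T0) t t) ltnn andbF.
  case: ifPn => tT.
    by apply: eq_bigr => N1 _; rewrite braid_natural // tT mul1r setU1K.
  by rewrite big1 // => v _; rewrite braid_natural // (negPf tT) !mul0r scale0r.
rewrite -(sum_setD1 (fun T t T0 => \sum_N1
   (z ^+ above T t * braid z 0 T N1 J N) *: (minor M N1 * (minor I T0 * x i t)))).
rewrite scaler_sumr; apply: eq_bigr => T _ /=.
rewrite exchange_big scaler_sumr; apply: eq_bigr => N1 _ /=.
have := minor_insert I T i; rewrite iI mul1r scalerA [z ^+ _ * _]mulrC -scalerA scalerAr => <-.
rewrite mulr_sumr scaler_sumr; apply: eq_bigr => t _.
rewrite -scalerAr !scalerA.
by congr (_ *: _); ring.
Qed.

End Minors.

(** * The order on index sets and the exponent [calL] in terms of heights *)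

Section Ranks.
Context (n : nat).
Implicit Types (I S T U V : {set 'I_n}) (p : 'I_n).

Lemma below_count I (p : 'I_n) : below I p = count (fun a : 'I_n => (a < p)%N) (enum I).
Proof.
rewrite -size_filter /below cardE /enum_mem -filter_predI.
by congr size; apply: eq_filter => a; rewrite !inE andbC.
Qed.

Lemma below_nth_enum I x0 l : (l < #|I|)%N -> below I (nth x0 (enum I) l) = l.
Proof.
move=> lI; rewrite below_count.
have := count_lt_nth (val x0) (sorted_val_enum I).
rewrite size_map -cardE => /(_ _ lI); rewrite count_map (nth_map x0) -?cardE //.
Qed.

Lemma below_enum_val I (l : 'I_#|I|) : below I (enum_val l) = l.
Proof. by rewrite (enum_val_nth (enum_val l)) below_nth_enum. Qed.

(** This makes [S <= I] the condition that the path of heights started at 0 never becomes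
    negative. *)
Lemma index_leP I S : #|S| = #|I| ->
  reflect (forall p, (below I p <= below S p)%N) (index_le S I).
Proof.
move=> cardSI; apply: (iffP idP) => [le_SI p|le_below].
  rewrite !below_count; move: le_SI; rewrite /index_le; elim: (enum S) (enum I) => [|s S' IHS] [|i I'] //=.
  move=> /andP[si /IHS]; apply: leq_add.
  by case: ltnP => // ip; rewrite (leq_ltn_trans si ip).
rewrite /index_le all2E -!cardE cardSI eqxx /=.
apply/allP => -[s i] /(nthP (s, i))[l]; rewrite size_zip -!cardE cardSI minnn => lI.
rewrite nth_zip -?cardE // => -[sE iE] /=; rewrite leqNgt; apply/negP => i_lt_s.
(* If the elements [i < s] both have position [l], then [l] elements of [S] but at least [l + 1]
   elements of [I] lie below [s]. *)
have := le_below s; rewrite -[in X in (_ <= X)%N]sE below_nth_enum ?cardSI // leqNgt.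
case/negP; rewrite -[X in (X < _)%N](below_nth_enum i lI) iE.
rewrite /below (cardsD1 i [set a in I | (a < s)%N]) !inE i_lt_s -iE -mem_enum mem_nth -?cardE //=.
apply/subset_leq_card/subsetP => a; rewrite !inE => /andP[-> ai] /=.
rewrite iE in ai *; rewrite (ltn_trans ai i_lt_s) andbT.
by apply: contraTneq ai => ->; rewrite ltnn.
Qed.

Lemma below_diff I S p : 
  (below S p)%:Z - (below I p)%:Z = (below (S :\: I) p)%:Z - (below (I :\: S) p)%:Z.
Proof.
suff E A B : below A p = (below (A :&: B) p + below (A :\: B) p)%N.
  by rewrite (E S I) (E I S) setIC !PoszD; ring.
rewrite /below -(cardsID B); congr addn; apply: eq_card => a; rewrite !inE.
  by rewrite andbAC.
by rewrite andbA.
Qed.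

Lemma ell_below S T : ell S T = (\sum_(s in S) below T s)%N.
Proof.
rewrite /ell -sum1dep_card.
under [RHS]eq_bigr => s _ do rewrite /below -sum1dep_card.
rewrite pair_big_dep /=; apply: eq_bigl => -[a b]; by rewrite !inE andbA.
Qed.

(** This turns [(- q) ^ calL S I M] into a product of local factors. *)
Lemma calL_height S I M :
  calL S I M = \sum_(w in (S :\: natural I M S) :|: (M :\: I)) - height 0 I S w.
Proof.
rewrite /calL !ell_below !(big_morph Posz PoszD (erefl _)) -sumrB.
by apply: eq_bigr => w _; rewrite /height add0r below_diff opprB.
Qed.

End Ranks.

(** * The coefficients lambda and mu *)

Section Xi.
Context (k : fieldType) (q : k) (q_neq0 : q != 0).
Let z := - q.

(** The sum telescopes along [z ^ (d - 2 i)]. The result is the weight of an index of [I :\: S] at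
    height [d]. *)
Lemma qhat_qnum d : qhat q * qnum q d = z ^ (- d%:Z) - z ^ d%:Z.
Proof.
have z0 : z != 0 by rewrite oppr_eq0.
rewrite /qnum -(big_mkord xpredT (fun i => (- q) ^ (d%:Z - 1 - (2 * i)%N%:Z))).
rewrite big_distrr /= (telescope_sumr_eq (fun i => z ^ (d%:Z - (2 * i)%N%:Z))) //.
  by rewrite muln0 subr0; congr (z ^ _ - _); lia.
move=> i _; rewrite -/z.
rewrite (_ : d%:Z - (2 * i.+1)%N%:Z = d%:Z - 1 - (2 * i)%N%:Z - 1); last by lia.
rewrite (_ : d%:Z - (2 * i)%N%:Z = d%:Z - 1 - (2 * i)%N%:Z + 1); last by lia.
move: (d%:Z - 1 - _) => a; rewrite !expfzDr // exprN1 expr1z /qhat.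
have -> : q = - z by rewrite /z opprK.
by field; rewrite ?oppr_eq0 ?q_neq0 ?z0.
Qed.

Lemma xi_prod n (U V : {set 'I_n}) :
  xi q U V = \prod_(u in U) qnum q (#|[set v in V | (v <= u)%N]| - below U u).
Proof.
by rewrite big_enum_val; apply: eq_bigr => l _; rewrite below_enum_val.
Qed.

(** Going down from height 0 has weight [z ^ 0 - z ^ 0], so such a path contributes nothing. *)
Lemma braid_height_ge0 n h (I M S S' : {set 'I_n}) : 0 <= h ->
  braid z h I M S S' != 0 -> forall p, 0 <= height h I S p.
Proof.
elim: n h I M S S' => [|n IHn] h I M S S' h0; first by move=> _ [].
rewrite braidS mulf_eq0 negb_or => /andP[w0 /IHn{}IHn] p.
case: (unliftP ord0 p) => [p'|] ->; rewrite /height ?below0 ?subr0 ?addr0 //.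
rewrite !below_lift.
suff h'0 : 0 <= h + (ord0 \in S)%:Z - (ord0 \in I)%:Z.
  have := IHn h'0 p'; rewrite /height !PoszD; congr (_ <= _); ring.
have [h_0|hn0] := eqVneq h 0; last by case: (_ \in S); case: (_ \in I) => /=; lia.
move: w0; rewrite h_0; case: (ord0 \in S); case: (ord0 \in I) => //=.
by case: (ord0 \in M); case: (ord0 \in S'); rewrite ?oppr0 ?subrr eqxx.
Qed.

(** Every nonzero local weight preserves the number of memberships at its index, which determines
    [S']; the order relation comes from the nonnegative heights. *)
Lemma braid_support n (I M S S' : {set 'I_n}) : braid z 0 I M S S' != 0 ->
  [/\ S' = natural I M S, I :&: M \subset S, S \subset I :|: M, #|S| = #|I| &
    index_le S I].
Proof.
move=> b0; have h0 := braid_height_ge0 (lexx 0) b0.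
move: b0; rewrite /braid; have [/eqP cS|] := boolP (_ == 0 :> int); last by rewrite mul0r eqxx.
rewrite mul1r => /prodf_neq0 w0.
have cSI : #|S| = #|I| by lia.
have bits p : ((p \in I) + (p \in M) = (p \in S) + (p \in S') :> nat)%N.
  have := w0 p isT; move: (height _ _ _ _) => h.
  by case: (p \in I); case: (p \in M); case: (p \in S); case: (p \in S'); rewrite //= eqxx.
split=> //.
- apply/setP => p; rewrite !inE; have := bits p.
  by case: (p \in I); case: (p \in M); case: (p \in S); case: (p \in S').
- apply/subsetP => p; rewrite !inE; have := bits p.
  by case: (p \in I); case: (p \in M); case: (p \in S); case: (p \in S').
- apply/subsetP => p; rewrite !inE; have := bits p.
  by case: (p \in I); case: (p \in M); case: (p \in S); case: (p \in S').
- by apply/index_leP => // p; have := h0 p; rewrite /height; lia.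
Qed.

(** Each local weight is a product of three factors: [q] on [I :&: M], a [qhat]-multiple of a
    quantum integer on [I :\: S], and a power of [z] on [W]. Their products over all indices are the
    factors of the right-hand side. *)
Lemma braid_lambda n (I M S : {set 'I_n}) :
  I :&: M \subset S -> S \subset I :|: M -> index_le S I -> #|S| = #|I| ->
  braid z 0 I M S (natural I M S) = q ^+ #|I :&: M| * lambda q I M S.
Proof.
move=> /subsetP IMS /subsetP SIM /[swap] cSI /(index_leP cSI) le_SI.
have z0 : z != 0 by rewrite oppr_eq0.
rewrite /braid cSI add0r subrr eqxx mul1r.
pose W := (S :\: natural I M S) :|: (M :\: I).
transitivity (\prod_(p < n) ((if p \in I :&: M then q else 1) *
   (if p \in I :\: S then qhat q * qnum q (#|[set v in S :\: I | (v <= p)%N]| - below (I :\: S) p) else 1) *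
   (if p \in W then z ^ (- height 0 I S p) else 1))).
  apply: eq_bigr => p _.
  (* The integer [d_l] in [xi] is the height at [p]: since [p] is not in [S :\: I], the bounds
     [v <= p] and [v < p] count the same elements, and [S <= I] makes the subtraction exact. *)
  have dE : p \in I :\: S ->
    (#|[set v in S :\: I | (v <= p)%N]| - below (I :\: S) p)%N%:Z = height 0 I S p.
    rewrite inE => /andP[pS pI].
    have -> : #|[set v in S :\: I | (v <= p)%N]| = below (S :\: I) p.
      apply: eq_card => v; rewrite !inE leq_eqVlt.
      by have [/val_inj ->|] := eqVneq (v : nat) p; rewrite ?pI ?andbF.
    by have := le_SI p; have := below_diff I S p; rewrite /height; lia.
  move: dE (IMS p) (SIM p); rewrite /W !inE qhat_qnum.
  case: (p \in I); case: (p \in M); case: (p \in S) => //= dE b1 b2;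
    rewrite ?(mulr1, mul1r) ?dE //.
  - by rewrite /z opprK.
  - by have := b1 isT.
  - by have := b2 isT.
rewrite !big_split -!big_mkcond big_split /= !prodr_const -xi_prod mulrA.
rewrite /lambda calL_height -/W (big_morph _ (fun a b => expfzDr a b z0) (expr0z z)).
by ring.
Qed.

Lemma lambda_id n (I M : {set 'I_n}) : lambda q I M I = 1.
Proof.
rewrite /lambda setDv cards0 expr0 mul1r xi_prod big_set0 mulr1 /calL setDv.
by rewrite subrr expr0z.
Qed.

Lemma natural_id n (I M : {set 'I_n}) : natural I M I = M.
Proof. by apply/setP => p; rewrite !inE; case: (p \in I); case: (p \in M). Qed.

Lemma naturalK n (J N T : {set 'I_n}) :
  J :&: N \subset T -> T \subset J :|: N ->
  [/\ natural T (natural J N T) J = N, T :&: natural J N T = J :&: N &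
      T :|: natural J N T = J :|: N].
Proof.
move=> /subsetP JNT /subsetP TJN; split; apply/setP => p; have := JNT p; have := TJN p;
  rewrite !inE; case: (p \in T); case: (p \in J); case: (p \in N) => //=;
  by move=> // H1 H2; rewrite ?(H1 isT) ?(H2 isT).
Qed.

(** [(J, N)] is obtained from [(T, natural J N T)] just as [(S, natural I M S)] is from [(I, M)], so
    [mu] needs no computation of its own. *)
Lemma mu_lambda n (J N T : {set 'I_n}) :
  J :&: N \subset T -> T \subset J :|: N -> mu q J N T = lambda q T (natural J N T) J.
Proof.
move=> JNT TJN; rewrite /mu /lambda /calL /calL_natural.
by have [-> _ _] := naturalK JNT TJN; rewrite [X in ell X]setUC.
Qed.

End Xi.

(** * Rows and columns of the braiding matrix as the two sums of the theorem *)

Section Collapse.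
Context (k : fieldType) (q : k) (q_neq0 : q != 0) (n : nat) (V : lmodType k).

Lemma index_le_refl (I : {set 'I_n}) : index_le I I.
Proof. by apply/index_leP. Qed.

(** The entry at [S = I] is the leading term; any other nonzero entry of the row has [S < I] and a
    determined [S']. *)
Lemma sum_braid_left (I M : {set 'I_n}) (F : {set 'I_n} -> {set 'I_n} -> V) :
  \sum_S \sum_S' braid (- q) 0 I M S S' *: F S S' =
  q ^+ #|I :&: M| *: F I M + q ^+ #|I :&: M| *:
    \sum_(S in lt_sets I M) lambda q I M S *: F S (natural I M S).
Proof.
transitivity (\sum_S braid (- q) 0 I M S (natural I M S) *: F S (natural I M S)).
  apply: eq_bigr => S _; rewrite (bigD1 (natural I M S)) //= big1 ?addr0 // => S' S'n.
  have [->|/(braid_support q_neq0)[e _ _ _ _]] := eqVneq (braid (- q) 0 I M S S') 0.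
    by rewrite scale0r.
  by rewrite e eqxx in S'n.
rewrite (bigD1 I) //= scaler_sumr natural_id; congr (_ + _).
  rewrite -[X in braid _ _ _ _ _ X](natural_id I M) (braid_lambda q_neq0) ?lambda_id ?mulr1 //.
  - exact: subsetIl.
  - exact: subsetUl.
  - exact: index_le_refl.
rewrite big_mkcond [RHS]big_mkcond; apply: eq_bigr => S _.
rewrite !inE /index_lt.
case: ifPn => [SI|]; last by rewrite negbK => /eqP ->; rewrite eqxx !andbF.
rewrite andbT; case: ifPn => [/and4P[SIM IMS /eqP cS le_S]|nS].
  by rewrite braid_lambda // scalerA.
have [->|/(braid_support q_neq0)[_ h1 h2 h3 h4]] := eqVneq (braid (- q) 0 I M S (natural I M S)) 0.
  by rewrite scale0r.
by rewrite h1 h2 h3 h4 eqxx in nS.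
Qed.

Lemma sum_braid_right (J N : {set 'I_n}) (F : {set 'I_n} -> {set 'I_n} -> V) :
  \sum_T \sum_T' braid (- q) 0 T T' J N *: F T T' =
  q ^+ #|J :&: N| *: F J N + q ^+ #|J :&: N| *:
    \sum_(T in gt_sets J N) mu q J N T *: F T (natural J N T).
Proof.
(* [braid_support] describes [(J, N)] in terms of [(T, T')]; here this is solved for [T']. *)
have support T T' : braid (- q) 0 T T' J N != 0 ->
  [/\ T' = natural J N T, J :&: N \subset T, T \subset J :|: N, #|T| = #|J| & index_le J T].
  move=> /(braid_support q_neq0)[e h1 h2 h3 h4]; split=> //.
  - apply/setP => p; have /subsetP/(_ p) := h1; have /subsetP/(_ p) := h2.
    rewrite e !inE; case: (p \in T); case: (p \in J); case: (p \in T') => //=.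
      by move=> _ /(_ isT).
    by move=> /(_ isT).
  - by apply/subsetP => p; rewrite e !inE; case: (p \in T); case: (p \in J); case: (p \in T').
  - by apply/subsetP => p; rewrite e !inE; case: (p \in T); case: (p \in J); case: (p \in T').
transitivity (\sum_T braid (- q) 0 T (natural J N T) J N *: F T (natural J N T)).
  apply: eq_bigr => T _; rewrite (bigD1 (natural J N T)) //= big1 ?addr0 // => T' T'n.
  have [->|/support[e _ _ _ _]] := eqVneq (braid (- q) 0 T T' J N) 0.
    by rewrite scale0r.
  by rewrite e eqxx in T'n.
have braid_mu (T : {set 'I_n}) : J :&: N \subset T -> T \subset J :|: N -> index_le J T -> #|T| = #|J| ->
    braid (- q) 0 T (natural J N T) J N = q ^+ #|J :&: N| * mu q J N T.
  move=> JNT TJN JT cT; have [eN eI eU] := naturalK JNT TJN.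
  have := @braid_lambda _ _ q_neq0 _ T (natural J N T) J.
  rewrite eN eI eU => -> //; rewrite ?mu_lambda ?subsetIl ?subsetUl //.
rewrite (bigD1 J) //= scaler_sumr natural_id; congr (_ + _).
  rewrite -[X in braid _ _ _ X](natural_id J N) braid_mu ?subsetIl ?subsetUl ?index_le_refl //.
  by rewrite mu_lambda ?subsetIl ?subsetUl // lambda_id mulr1.
rewrite big_mkcond [RHS]big_mkcond; apply: eq_bigr => T _.
rewrite !inE /index_lt.
case: ifPn => [TJ|]; last by rewrite negbK => /eqP ->; rewrite !eqxx !andbF.
rewrite [J == T]eq_sym TJ andbT; case: ifPn => [/and4P[TJN JNT /eqP cT le_T]|nT].
  by rewrite braid_mu // scalerA.
have [->|/support[_ h1 h2 h3 h4]] := eqVneq (braid (- q) 0 T (natural J N T) J N) 0.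
  by rewrite scale0r.
by rewrite h1 h2 h3 h4 eqxx in nT.
Qed.

End Collapse.

(** * The permutation formula for minors *)

Lemma perm_length_sum t (s : 'S_t) :
  perm_length s = (\sum_(a < t) \sum_(b < t) ((a < b) && (s b < s a)))%N.
Proof.
rewrite /perm_length -sum1dep_card pair_bigA big_mkcond /=.
by apply: eq_bigr => -[a b] _ /=; case: ifP.
Qed.

Lemma widen_lift_max t (i : 'I_t) : widen_ord (leqnSn t) i = lift ord_max i.
Proof. by apply: ord_inj; rewrite lift_max. Qed.

(** The last position, sent to [c], forms an inversion with each of the [t - c] larger values; the
    other inversions are those of [s]. *)
Lemma perm_length_lift_max t (c : 'I_t.+1) (s : 'S_t) :
  perm_length (lift_perm ord_max c s) = (t - c + perm_length s)%N.
Proof.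
rewrite !perm_length_sum big_ord_recr /= [X in (_ + X)%N]big1 ?addn0; last first.
  by move=> b _; rewrite ltnNge -ltnS ltn_ord.
under eq_bigr => a _ do rewrite big_ord_recr /= widen_lift_max lift_perm_id lift_perm_lift.
rewrite big_split [RHS]addnC; congr (_ + _)%N.
  apply: eq_bigr => a _; apply: eq_bigr => b _.
  rewrite !widen_lift_max !lift_perm_lift /=; congr (nat_of_bool (_ && _)).
  by rewrite /bump; do 2!case: leqP; lia.
transitivity (\sum_(a < t) (c <= s a))%N.
  apply: eq_bigr => a _; rewrite ltn_ord /= /bump; congr nat_of_bool.
  by case: leqP; lia.
transitivity (\sum_(a < t) (c <= a))%N; first by rewrite [RHS](reindex_perm s).
rewrite -(big_mkord xpredT (fun a => (c <= a)%N : nat)).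
rewrite (@big_cat_nat _ _ _ c) //=; last by rewrite -ltnS.
rewrite big_nat big1 ?add0n => [|a /andP[_ ac]]; last by rewrite leqNgt ac.
rewrite big_nat (eq_bigr (fun=> 1%N)) => [|a /andP[-> _] //].
by rewrite -big_nat sum_nat_const_nat muln1.
Qed.

Lemma lift_perm_max_bij t :
  bijective (fun cs : 'I_t.+1 * 'S_t => lift_perm ord_max cs.1 cs.2).
Proof.
apply: inj_card_bij => [[c s] [c' s'] /= e|]; last first.
  by rewrite card_prod card_ord !card_Sn factS.
have ec : c = c' by have := congr1 (fun u : 'S__ => u ord_max) e; rewrite !lift_perm_id.
congr pair => //; apply/permP => i.
have := congr1 (fun u : 'S__ => u (lift ord_max i)) e; rewrite !lift_perm_lift ec.
exact: lift_inj.
Qed.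

Lemma below_above n (J : {set 'I_n}) j :
  #|J| = (below J j + (j \in J) + above J j)%N.
Proof.
rewrite /below /above !cardset_bool card_sum_mem.
rewrite -[X in (_ + X + _)%N]mul1n -(big_pred1_eq addn j (fun a => 1 * (a \in J))%N).
rewrite [X in (_ + X + _)%N]big_mkcond -!big_split; apply: eq_bigr => a _ /=.
case: (a \in J) => /=; last by rewrite if_same.
have -> : (a == j) = (a == j :> nat) by [].
by case: eqP; lia.
Qed.

Section Expand.
Context (k : fieldType) (n : nat) (q : k) (A : algType k) (x : 'I_n -> 'I_n -> A).

Lemma nth_enum_setD1 (J : {set 'I_n}) x0 c l : (c < #|J|)%N ->
  nth x0 (enum (J :\ nth x0 (enum J) c)) l = nth x0 (enum J) (bump c l).
Proof.
move=> cJ; set j := nth x0 (enum J) c.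
have -> : enum (J :\ j) = rem j (enum J).
  rewrite rem_filter ?enum_uniq // /enum_mem -filter_predI.
  by apply: eq_filter => a; rewrite !inE.
rewrite remE index_uniq -?cardE ?enum_uniq // nth_cat size_take -cardE cJ /bump.
case: ltnP => lc; first by rewrite nth_take.
by rewrite nth_drop; congr nth; lia.
Qed.

(** Expansion along the last row, grouping permutations by the image [c] of the last position. The
    rows form an arbitrary family [a], so that dropping one stays within the statement. *)
Lemma perm_sum_word_minor t (a : 'I_t -> 'I_n) (J : {set 'I_n}) : #|J| = t ->
  \sum_(s : 'S_t) (- q) ^+ perm_length s *:
    \prod_(l < t) x (a l) (nth (a l) (enum J) (s l)) =
  word_minor q x (rev [seq a l | l <- enum 'I_t]) J.
Proof.
elim: t a J => [|t IHt] a J cJ.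
  rewrite enum_ord0 (big_pred1 1%g) => [|s]; last first.
    by symmetry; apply/eqP/permP => -[].
  rewrite big_ord0 perm_length_sum big_ord0 scale1r.
  by move/eqP: cJ; rewrite cards_eq0 /= => ->.
rewrite enum_ordSr map_rcons rev_rcons /= -map_comp.
rewrite (reindex _ (onW_bij _ (lift_perm_max_bij t))) /=.
rewrite -(pair_bigA _ (fun c s => (- q) ^+ perm_length (lift_perm ord_max c s) *:
  \prod_(l < t.+1) x (a l) (nth (a l) (enum J) (lift_perm ord_max c s l)))) /=.
rewrite -[RHS]big_enum /= (big_nth (a ord_max)) -cardE cJ big_mkord.
apply: eq_bigr => c _.
have cJ' : (c < #|J|)%N by rewrite cJ.
set j := nth (a ord_max) (enum J) c.
have jJ : j \in J by rewrite -mem_enum mem_nth -?cardE.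
(* The column [j] has position [c], counted from 0, among [t + 1] columns, so the new inversions
   match the exponent in the row expansion. *)
have -> : above J j = (t - c)%N.
  have := below_nth_enum (a ord_max) cJ'; rewrite -/j.
  by have := below_above J j; rewrite cJ jJ; lia.
have cJj : #|J :\ j| = t by have := cardsD1 j J; rewrite jJ cJ add1n => -[].
rewrite -[rev _]/(rev [seq a (widen_ord (leqnSn t) l) | l <- enum 'I_t]) -(IHt _ _ cJj).
rewrite mulr_suml scaler_sumr; apply: eq_bigr => s _.
rewrite perm_length_lift_max exprD -scalerA -scalerAl; congr (_ *: (_ *: _)).
rewrite big_ord_recr /= lift_perm_id; congr (_ * _).
apply: eq_bigr => l _; rewrite widen_lift_max lift_perm_lift /=.
rewrite -nth_enum_setD1 //.
(* The default value of [nth] varies with the row, but all positions are in range. *)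
rewrite (set_nth_default (a ord_max)) ?(set_nth_default (a ord_max) (a (lift _ _))) //;
  by rewrite -cardE -/j ?cJj.
Qed.
End Expand.

Lemma qminorE (k : fieldType) n (q : k) (I J : {set 'I_n}) : #|I| = #|J| ->
  qminor q I J = minor q (qmx_gen q) I J.
Proof.
move=> cIJ; rewrite /minor /qminor perm_sum_word_minor //.
congr (word_minor _ _ (rev _) _).
have [I0|[x0 _]] := set_0Vmem I.
  have cI0 : #|I| = 0%N by rewrite I0 cards0.
  by rewrite [RHS]size0nil -?cardE //; apply: size0nil; rewrite size_map size_enum_ord.
rewrite (eq_map (enum_val_nth x0)) (map_comp (nth x0 (enum I)) val) val_enum_ord.
by rewrite cardE map_nth_iota0 // take_size.
Qed.

(** [D] is controlled only on sets of equal size, so the sizes of [S], [T] and their [natural]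
    partners have to be followed through both sums. *)
Lemma minor_commutation (k : fieldType) n (q : k) (A : algType k)
    (x : 'I_n -> 'I_n -> A) (D : {set 'I_n} -> {set 'I_n} -> A) :
  q != 0 -> qmx_relations q x ->
  (forall I J : {set 'I_n}, #|I| = #|J| -> D I J = minor q x I J) ->
  forall I J M N : {set 'I_n}, #|I| = #|J| -> #|M| = #|N| ->
  q ^+ #|I :&: M| *: (D I J * D M N)
  + q ^+ #|I :&: M| *:
      \sum_(S in lt_sets I M) lambda q I M S *: (D S J * D (natural I M S) N)
  = q ^+ #|J :&: N| *: (D M N * D I J)
    + q ^+ #|J :&: N| *:
        \sum_(T in gt_sets J N) mu q J N T *: (D M (natural J N T) * D I T).
Proof.
move=> q0 xP DE I J M N cardIJ cardMN.
have card_natural (X Y S : {set 'I_n}) : X :&: Y \subset S -> S \subset X :|: Y ->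
    #|S| = #|X| -> #|natural X Y S| = #|Y|.
  move=> XYS SXY cS; have [_ eI eU] := naturalK XYS SXY.
  have := cardsUI S (natural X Y S); rewrite eI eU cardsUI cS.
  by move/addnI.
have := minor_braid q0 xP I M J N.
rewrite (sum_braid_left q0 I M (fun S S' => minor q x S J * minor q x S' N)).
rewrite (sum_braid_right q0 J N (fun T T' => minor q x M T' * minor q x I T)).
rewrite -!DE // => main.
transitivity (q ^+ #|I :&: M| *: (D I J * D M N)
  + q ^+ #|I :&: M| *:
      \sum_(S in lt_sets I M) lambda q I M S *: (minor q x S J * minor q x (natural I M S) N)).
  congr (_ + _ *: _); apply: eq_bigr => S; rewrite inE => /and4P[SIM IMS /eqP cS _].
  by rewrite !DE ?cS ?(card_natural _ _ _ IMS).
rewrite main; congr (_ + _ *: _); apply: eq_bigr => T.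
rewrite inE => /and4P[TJN JNT /eqP cT _].
by rewrite !DE ?cT ?(card_natural _ _ _ JNT).
Qed.

Theorem theorem5p2 (k : fieldType) (n : nat) (n_gt0 : (0 < n)%N)
    (q : k) (q_neq0 : q != 0) (I J M N : {set 'I_n})
    (cardIJ : #|I| = #|J|) (cardMN : #|M| = #|N|) :
  q ^+ #|I :&: M| *: (qminor q I J * qminor q M N)
  + q ^+ #|I :&: M| *:
      \sum_(S in lt_sets I M)
         lambda q I M S *: (qminor q S J * qminor q (natural I M S) N)
  = q ^+ #|J :&: N| *: (qminor q M N * qminor q I J)
    + q ^+ #|J :&: N| *:
        \sum_(T in gt_sets J N)
           mu q J N T *: (qminor q M (natural J N T) * qminor q I T).
Proof.
exact: (minor_commutation (D := @qminor k n q) q_neq0 (@qmx_genP k n q) (@qminorE k n q)).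
Qed.
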